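(* Let $\lambda>0$. For every $\alpha\in\mathbb{R}$ and every $\beta>1$, the boundary value problem $$f'''+(1+\lambda)ff''+2\lambda(1-f')f'=0\quad\text{on }[0,\infty),$$ $$f(0)=\alpha,\qquad f'(0)=\beta,\qquad f'(\infty)=1,$$ admits a unique concave solution.
   Context: Here $f:[0,\infty)\to\mathbb{R}$ is a (three times differentiable) real-valued function of $t\in[0,\infty)$, primes denote derivatives with respect to $t$, and $f'(\infty):=\lim_{t\to\infty}f'(t)$. A solution is called concave if $f''(t)<0$ for all $t\in[0,\infty)$ (strict inequality). *)

(* Defs.v *)
From Stdlib Require Import Reals.
From Coquelicot Require Import Coquelicot.
Open Scope R_scope.

(* A function [0,oo) -> R is encoded by a total function R -> R of which only
   the values on [0,oo) matter. *)
Definition halfline (t : R) : Prop := 0 <= t.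

(* [D_in] takes the limit of the difference quotient inside the domain, so at
   t = 0 the derivative is one-sided. *)
Definition has_derivative_on_halfline (f f' : R -> R) : Prop :=
  forall t : R, halfline t -> D_in f f' halfline t.

Definition is_bvp_solution (lambda alpha beta : R) (f f' f'' f''' : R -> R) : Prop :=
  has_derivative_on_halfline f f' /\
  has_derivative_on_halfline f' f'' /\
  has_derivative_on_halfline f'' f''' /\
  (forall t : R, halfline t ->
     f''' t + (1 + lambda) * f t * f'' t + 2 * lambda * (1 - f' t) * f' t = 0) /\
  f 0 = alpha /\
  f' 0 = beta /\
  is_lim f' p_infty 1.

(* The derivatives are determined by f on [0,oo), so the existential over them
   involves no choice. Concavity is strict: f'' < 0 everywhere. *)
Definition is_concave_solution (lambda alpha beta : R) (f : R -> R) : Prop :=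
  exists f' f'' f''' : R -> R,
    is_bvp_solution lambda alpha beta f f' f'' f''' /\
    (forall t : R, halfline t -> f'' t < 0).

(* Main.v *)
(* With y = f' and z = f'', concavity and y -> 1 force 1 < y <= beta along a solution.
   Uniqueness: at a first zero of the difference of two curvatures the equation
   makes the derivative of this difference positive, so the solution with the larger
   f''(0) keeps the larger f'' and the two slopes cannot have the same limit.
   Existence is by shooting on gamma = f''(0). The gamma for which z becomes positive
   while y > 1, and those for which y falls below 1 while z < 0, form disjoint open
   sets; the first contains 0 and the second contains all very negative gamma. The
   supremum of the second set is in neither, and since (y, z) = (1, 0) is an
   equilibrium, y > 1 and z < 0 hold forever along it. The limit of y is then 1, for
   otherwise f -> oo and z' is eventually bounded below by a positive constant. *)
Require Import Defs.
From Stdlib Require Import Reals Lra Psatz.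
From Coquelicot Require Import Coquelicot.
Open Scope R_scope.

(** * Real functions of one variable *)

(** The right-hand side is quadratic, hence only locally Lipschitz, which guarantees no solution on
    all of [0,oo) for a prescribed gamma; yet shooting compares solutions on common intervals. It is
    therefore carried out on a truncated equation, where x, y and z are clamped to time-dependent
    bounds: there every gamma gives a global solution, and on bounded intervals the dependence on
    gamma is Lipschitz. The bounds are the a priori estimates implied by y >= 1 and z <= 0, so it is
    enough to return to the original equation for the critical solution. In the (y, z) plane the
    sides of the region y > 1, z < 0 are crossed transversally: z' > 0 where z = 0 and y > 1, and y'
    < 0 where y = 1 and z < 0. Reaching a side thus leads to strict inequalities on a compact time
    interval, which persist for nearby gamma. Only the corner (1, 0) lacks this transversality. For
    uniqueness, comparison in both directions yields only equality of f''(0); a Gronwall estimate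
    for the original equation then identifies the solutions. *)

Lemma is_derive_continuous (u : R -> R) (t l : R) :
  is_derive u t l -> continuous u t.
Proof. intros H. apply (ex_derive_continuous u). now exists l. Qed.

Lemma is_derive_continuity_pt (u : R -> R) (t l : R) :
  is_derive u t l -> continuity_pt u t.
Proof.
  intros H. apply continuity_pt_filterlim. exact (is_derive_continuous u t l H).
Qed.

Lemma increment_le (u v du dv : R -> R) (a b : R) :
  a <= b ->
  (forall t, a <= t <= b -> is_derive u t (du t)) ->
  (forall t, a <= t <= b -> is_derive v t (dv t)) ->
  (forall t, a <= t <= b -> du t <= dv t) ->
  u b - u a <= v b - v a.
Proof.
  intros Hab Hu Hv Hd.
  assert (D : forall t, a <= t <= b -> is_derive (fun s => v s - u s) t (dv t - du t)).
  { intros t Ht. apply (is_derive_minus v u t (dv t) (du t)); auto. }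
  destruct (MVT_gen (fun s => v s - u s) a b (fun s => dv s - du s)) as [c [Hc E]].
  - intros t Ht. rewrite Rmin_left, Rmax_right in Ht by lra. apply D. lra.
  - intros t Ht. rewrite Rmin_left, Rmax_right in Ht by lra.
    apply (is_derive_continuity_pt _ _ (dv t - du t)). apply D. lra.
  - rewrite Rmin_left, Rmax_right in Hc by lra. specialize (Hd c Hc). nra.
Qed.

Lemma increment_abs_le (u v du dv : R -> R) (a b : R) :
  a <= b ->
  (forall t, a <= t <= b -> is_derive u t (du t)) ->
  (forall t, a <= t <= b -> is_derive v t (dv t)) ->
  (forall t, a <= t <= b -> Rabs (du t) <= dv t) ->
  Rabs (u b - u a) <= v b - v a.
Proof.
  intros Hab Hu Hv Hd. apply Rabs_le. split.
  - enough (- (v b) - - (v a) <= u b - u a) by lra.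
    apply (increment_le (fun t => - v t) u (fun t => - dv t) du); auto.
    + intros t Ht. apply (is_derive_opp v t (dv t)); auto.
    + intros t Ht. specialize (Hd t Ht). apply Rabs_le_between in Hd. lra.
  - apply (increment_le u v du dv); auto.
    intros t Ht. specialize (Hd t Ht). apply Rabs_le_between in Hd. lra.
Qed.

Lemma increment_le_linear (u du : R -> R) (K a b : R) :
  a <= b ->
  (forall t, a <= t <= b -> is_derive u t (du t)) ->
  (forall t, a <= t <= b -> du t <= K) ->
  u b <= u a + K * (b - a).
Proof.
  intros Hab Hu Hd.
  assert (H := increment_le u (fun t => K * t) du (fun _ => K) a b Hab Hu).
  cbv beta in H. enough (u b - u a <= K * b - K * a) by lra.
  apply H; auto. intros t _. auto_derive; [easy | ring].
Qed.

(** With the integrating factor [exp (- (K * (t - a)))] the product becomes nondecreasing. [K] may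
    be negative, and the result then limits the rate of decay of [u]. *)
Lemma gronwall_lower (u du : R -> R) (K a b : R) :
  a <= b ->
  (forall t, a <= t <= b -> is_derive u t (du t)) ->
  (forall t, a <= t <= b -> K * u t <= du t) ->
  u a * exp (K * (b - a)) <= u b.
Proof.
  intros Hab Hu Hd.
  assert (D : forall t, a <= t <= b ->
    is_derive (fun s => u s * exp (- (K * (s - a)))) t
      ((du t - K * u t) * exp (- (K * (t - a))))).
  { intros t Ht. specialize (Hu t Ht). auto_derive.
    - now exists (du t).
    - replace (Derive (fun s : R => u s) t) with (du t) by (symmetry; now apply is_derive_unique).
      unfold Rminus. ring. }
  assert (H := increment_le (fun _ => 0) _ (fun _ => 0) _ a b Hab
                 (fun t _ => is_derive_const 0 t) D).
  cbv beta in H.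
  assert (H' : 0 - 0 <= u b * exp (- (K * (b - a))) - u a * exp (- (K * (a - a)))).
  { apply H. intros t Ht. specialize (Hd t Ht).
    apply Rmult_le_pos; [lra | apply Rlt_le, exp_pos]. }
  replace (- (K * (a - a))) with 0 in H' by ring. rewrite exp_0 in H'.
  assert (E : exp (- (K * (b - a))) * exp (K * (b - a)) = 1).
  { rewrite <- exp_plus, Rplus_opp_l. apply exp_0. }
  assert (P := exp_pos (K * (b - a))).
  replace (u b) with (u b * exp (- (K * (b - a))) * exp (K * (b - a)))
    by (rewrite Rmult_assoc, E; ring).
  apply Rmult_le_compat_r; lra.
Qed.

Lemma gronwall_upper (u du : R -> R) (K a b : R) :
  a <= b ->
  (forall t, a <= t <= b -> is_derive u t (du t)) ->
  (forall t, a <= t <= b -> du t <= K * u t) ->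
  u b <= u a * exp (K * (b - a)).
Proof.
  intros Hab Hu Hd.
  enough (- u a * exp (K * (b - a)) <= - u b) by lra.
  apply (gronwall_lower (fun t => - u t) (fun t => - du t)); auto.
  - intros t Ht. apply (is_derive_opp u t (du t)); auto.
  - intros t Ht. specialize (Hd t Ht). lra.
Qed.

Lemma continuous_gt_locally (p : R -> R) (t c : R) :
  continuous p t -> c < p t ->
  exists d, 0 < d /\ forall s, Rabs (s - t) < d -> c < p s.
Proof.
  intros Hp Hc.
  assert (He : 0 < p t - c) by lra.
  destruct (proj1 (filterlim_locally p (p t)) Hp (mkposreal _ He)) as [d Hd].
  exists d. split; [apply cond_pos |]. intros s Hs.
  specialize (Hd s Hs). unfold ball in Hd; simpl in Hd.
  unfold AbsRing_ball, abs, minus, plus, opp in Hd; simpl in Hd.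
  apply Rabs_lt_between in Hd. lra.
Qed.

(** [tau] is the supremum of the times up to which [p] stays positive; by continuity [p tau] can be
    neither positive nor negative. Every continuation argument below looks at this instant. *)
Lemma first_zero (p : R -> R) (T : R) :
  0 <= T -> (forall t, 0 <= t <= T -> continuous p t) ->
  0 < p 0 -> p T <= 0 ->
  exists tau, 0 < tau <= T /\ p tau = 0 /\ forall s, 0 <= s < tau -> 0 < p s.
Proof.
  intros HT Hc H0 HpT.
  set (E := fun s => 0 <= s <= T /\ forall r, 0 <= r <= s -> 0 < p r).
  destruct (completeness E) as [tau [Hub Hlub]].
  { exists T. intros s [Hs _]. lra. }
  { exists 0. split; [lra |]. intros r Hr. now replace r with 0 by lra. }
  assert (Ht0 : 0 <= tau).
  { apply Hub. split; [lra |]. intros r Hr. now replace r with 0 by lra. }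
  assert (HtT : tau <= T) by (apply Hlub; intros s [Hs _]; lra).
  assert (Hpos : forall s, 0 <= s < tau -> 0 < p s).
  { intros s Hs. destruct (Rlt_le_dec 0 (p s)) as [|Hn]; [easy |].
    assert (tau <= s); [| lra]. apply Hlub. intros r [Hr Hr'].
    destruct (Rle_lt_dec r s); [easy |]. specialize (Hr' s). lra. }
  assert (Hle : p tau <= 0).
  { destruct (Rle_lt_dec (p tau) 0) as [|Hn]; [easy |]. exfalso.
    assert (tau <> T) by (intros ->; lra).
    destruct (continuous_gt_locally p tau 0 (Hc tau ltac:(lra)) Hn) as [d [Hd Hn']].
    (* Positivity extends slightly beyond [tau]; the minimum keeps the later time within [0, T]. *)
    assert (HE : E (Rmin (tau + d / 2) T)).
    { assert (Hm := Rmin_r (tau + d / 2) T). assert (Hm' := Rmin_l (tau + d / 2) T).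
      split.
      - split; [apply Rmin_glb; lra | lra].
      - intros r Hr. destruct (Rlt_le_dec r tau); [apply Hpos; lra |].
        apply Hn'. apply Rabs_lt_between. lra. }
    apply Hub in HE. revert HE. unfold Rmin. destruct Rle_dec; lra. }
  assert (Ht : tau <> 0) by (intros ->; lra).
  assert (Hge : 0 <= p tau).
  { destruct (Rle_lt_dec 0 (p tau)) as [|Hn]; [easy |]. exfalso.
    destruct (continuous_gt_locally (fun t => - p t) tau 0) as [d [Hd Hn']].
    - apply (continuous_opp p). apply Hc. lra.
    - lra.
    - assert (Hm := Rmax_l (tau - d / 2) 0). assert (Hm' := Rmax_r (tau - d / 2) 0).
      assert (Hm'' : Rmax (tau - d / 2) 0 < tau) by (apply Rmax_lub_lt; lra).
      specialize (Hn' (Rmax (tau - d / 2) 0)).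
      specialize (Hpos (Rmax (tau - d / 2) 0)).
      assert (0 < - p (Rmax (tau - d / 2) 0)).
      { apply Hn', Rabs_lt_between. lra. }
      lra. }
  exists tau. repeat split; auto; lra.
Qed.

Lemma derive_pos_locally (u : R -> R) (t l : R) :
  is_derive u t l -> 0 < l ->
  exists d, 0 < d /\ (forall s, t < s < t + d -> u t < u s) /\
    (forall s, t - d < s < t -> u s < u t).
Proof.
  intros H Hl. apply is_derive_Reals in H.
  (* Accuracy [l] in the definition of the derivative already makes all small difference quotients
     positive. *)
  destruct (H l Hl) as [d Hd]. exists d. assert (Hd0 := cond_pos d).
  assert (K : forall h, h <> 0 -> Rabs h < d -> 0 < (u (t + h) - u t) / h).
  { intros h Hh Hh'. specialize (Hd h Hh Hh'). apply Rabs_lt_between in Hd. lra. }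
  repeat split; auto; intros s Hs; specialize (K (s - t) ltac:(lra));
    (assert (Ha : Rabs (s - t) < d) by (apply Rabs_lt_between; lra));
    specialize (K Ha); replace (t + (s - t)) with s in K by ring.
  - assert (X : u s - u t = (u s - u t) / (s - t) * (s - t)) by (field; lra). nra.
  - assert (X : u s - u t = (u s - u t) / (s - t) * (s - t)) by (field; lra). nra.
Qed.

Lemma continuous_Rmax (u v : R -> R) (t : R) :
  continuous u t -> continuous v t -> continuous (fun s => Rmax (u s) (v s)) t.
Proof.
  intros Hu Hv.
  apply (continuous_ext (fun s => / 2 * (u s + v s + Rabs (u s - v s)))).
  - intros s. unfold Rmax, Rabs. destruct Rle_dec, Rcase_abs; simpl; lra.
  - apply (continuous_scal_r (/ 2) (fun s => u s + v s + Rabs (u s - v s))).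
    apply (continuous_plus (fun s => u s + v s) (fun s => Rabs (u s - v s))).
    + now apply (continuous_plus u v).
    + apply continuous_Rabs_comp. now apply (continuous_minus u v).
Qed.

Lemma continuous_Rmin (u v : R -> R) (t : R) :
  continuous u t -> continuous v t -> continuous (fun s => Rmin (u s) (v s)) t.
Proof.
  intros Hu Hv.
  apply (continuous_ext (fun s => - Rmax (- u s) (- v s))).
  - intros s. unfold Rmax, Rmin. destruct Rle_dec, Rle_dec; simpl; lra.
  - apply (continuous_opp (fun s => Rmax (- u s) (- v s))).
    apply continuous_Rmax; [now apply (continuous_opp u) | now apply (continuous_opp v)].
Qed.

(** * Primitives with a prescribed value at 0 *)

Definition prim (a : R) (u : R -> R) (t : R) : R := a + RInt u 0 t.

Lemma prim_0 (a : R) (u : R -> R) : prim a u 0 = a.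
Proof. unfold prim. rewrite RInt_point. unfold zero; simpl. ring. Qed.

Lemma is_derive_prim (a : R) (u : R -> R) (t : R) :
  (forall s, continuous u s) -> is_derive (prim a u) t (u t).
Proof.
  intros Hu. unfold prim.
  replace (u t) with (0 + u t) by ring.
  apply (is_derive_plus (fun _ => a) (fun s => RInt u 0 s) t 0 (u t)).
  - apply (is_derive_const a t).
  - apply (is_derive_RInt u (fun s => RInt u 0 s) 0 t); [| apply Hu].
    exists (mkposreal 1 Rlt_0_1). intros y _. apply (RInt_correct u 0 y).
    apply ex_RInt_continuous. intros z _. apply Hu.
Qed.

Lemma continuous_prim (a : R) (u : R -> R) (t : R) :
  (forall s, continuous u s) -> continuous (prim a u) t.
Proof. intros Hu. eapply is_derive_continuous, is_derive_prim, Hu. Qed.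

(** The majorant [w] enters through its derivative rather than as an integral, because the weight
    used in the Picard iteration is known by its differential equation. *)
Lemma prim_dist (a : R) (u v w dw : R -> R) (t : R) :
  0 <= t ->
  (forall s, continuous u s) -> (forall s, continuous v s) ->
  (forall s, 0 <= s -> is_derive w s (dw s)) -> 0 <= w 0 ->
  (forall s, 0 <= s -> Rabs (u s - v s) <= dw s) ->
  Rabs (prim a u t - prim a v t) <= w t.
Proof.
  intros Ht Hu Hv Hw Hw0 Hd.
  assert (H := increment_abs_le (fun s => prim a u s - prim a v s) w
    (fun s => u s - v s) dw 0 t Ht).
  cbv beta in H. rewrite !prim_0, Rminus_diag, Rminus_0_r in H.
  enough (Rabs (prim a u t - prim a v t) <= w t - w 0) by lra.
  apply H.
  - intros s _. apply (is_derive_minus (prim a u) (prim a v) s (u s) (v s));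
      now apply is_derive_prim.
  - intros s Hs. apply Hw. lra.
  - intros s Hs. apply Hd. lra.
Qed.

(** * Picard iteration *)

(** Only [z] is iterated: [y] and [x] are recovered from it by integration, so the system becomes a
    fixed-point equation for a single function. *)
Definition picard_rhs (F : R -> R -> R -> R -> R) (a b : R) (z : R -> R) (t : R) : R :=
  F t (prim a (prim b z) t) (prim b z t) (z t).

(** Continuity along continuous curves replaces joint continuity in four variables; it is the form
    in which the integrands occur. *)
Definition continuous_rhs (F : R -> R -> R -> R -> R) : Prop :=
  forall x y z : R -> R,
    (forall t, continuous x t) -> (forall t, continuous y t) ->
    (forall t, continuous z t) ->
    forall t, continuous (fun s => F s (x s) (y s) (z s)) t.

Definition lipschitz_rhs (F : R -> R -> R -> R -> R) (L : R -> R) : Prop :=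
  forall t x y z x' y' z', 0 <= t ->
    Rabs (F t x y z - F t x' y' z') <=
      L t * (Rabs (x - x') + Rabs (y - y') + Rabs (z - z')).

Lemma continuous_picard_rhs F a b z :
  continuous_rhs F -> (forall t, continuous z t) ->
  forall t, continuous (picard_rhs F a b z) t.
Proof.
  intros HF Hz. unfold picard_rhs. apply (HF (prim a (prim b z)) (prim b z) z); auto.
  - intros t. apply continuous_prim. intros s. now apply continuous_prim.
  - intros t. now apply continuous_prim.
Qed.

(* In the norm [sup |u| / e] with [e' = k * e] and [k >= 6 * L], the Picard
   operator contracts distances by a factor 2. *)
Lemma picard_contraction F L k e a b g u v D t :
  continuous_rhs F -> lipschitz_rhs F L ->
  (forall s, 0 <= s -> 1 <= k s /\ 0 <= L s /\ 6 * L s <= k s) ->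
  (forall s, 0 <= s -> is_derive e s (k s * e s)) -> (forall s, 0 < e s) ->
  (forall s, continuous u s) -> (forall s, continuous v s) -> 0 <= D ->
  (forall s, 0 <= s -> Rabs (u s - v s) <= D * e s) -> 0 <= t ->
  Rabs (prim g (picard_rhs F a b u) t - prim g (picard_rhs F a b v) t)
    <= D / 2 * e t.
Proof.
  intros HFc HFl Hk He Hpos Hu Hv HD Hd Ht.
  assert (De : forall c s, 0 <= s -> is_derive (fun r => c * e r) s (c * (k s * e s))).
  { intros c s Hs. apply (is_derive_scal e s c (k s * e s)). now apply He. }
  assert (Hle : forall s, 0 <= s -> D * e s <= D * (k s * e s)).
  { intros s Hs. destruct (Hk s Hs) as [H _]. specialize (Hpos s).
    apply Rmult_le_compat_l; [easy |]. nra. }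
  assert (Hy : forall s, 0 <= s -> Rabs (prim b u s - prim b v s) <= D * e s).
  { intros s Hs. apply (prim_dist b u v (fun r => D * e r) (fun r => D * (k r * e r)));
      auto; [specialize (Hpos 0); nra |].
    intros r Hr. apply Rle_trans with (1 := Hd r Hr). auto. }
  assert (Hx : forall s, 0 <= s ->
    Rabs (prim a (prim b u) s - prim a (prim b v) s) <= D * e s).
  { intros s Hs. apply (prim_dist a _ _ (fun r => D * e r) (fun r => D * (k r * e r)));
      auto; try (intros r; now apply continuous_prim); [specialize (Hpos 0); nra |].
    intros r Hr. apply Rle_trans with (1 := Hy r Hr). auto. }
  apply (prim_dist g _ _ (fun r => D / 2 * e r) (fun r => D / 2 * (k r * e r))); auto;
    try (now apply continuous_picard_rhs); [specialize (Hpos 0); nra |].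
  intros s Hs. unfold picard_rhs.
  eapply Rle_trans; [now apply HFl |].
  specialize (Hx s Hs). specialize (Hy s Hs). specialize (Hd s Hs).
  destruct (Hk s Hs) as [_ [HL HLk]]. specialize (Hpos s).
  (* The three distances are each at most [D * e], and [6 * L <= k] turns [3 * L] into [k / 2]. *)
  apply Rle_trans with (L s * (3 * (D * e s))).
  - apply Rmult_le_compat_l; lra.
  - assert (0 <= D * e s) by nra. nra.
Qed.

(** Banach's fixed-point argument in the weighted norm: successive iterates approach each other
    geometrically relative to [e], the convergence is locally uniform, and so the limit is
    continuous and fixed by the operator. *)
Lemma picard (F : R -> R -> R -> R -> R) (L : R -> R) (a b g : R) :
  (forall t, continuous L t) -> continuous_rhs F -> lipschitz_rhs F L ->
  (forall t, 0 <= t -> 0 <= L t) ->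
  exists x y z : R -> R,
    x 0 = a /\ y 0 = b /\ z 0 = g /\
    forall t, 0 <= t ->
      is_derive x t (y t) /\ is_derive y t (z t) /\
      is_derive z t (F t (x t) (y t) (z t)).
Proof.
  intros HLc HFc HFl HL0.
  set (S := fun z => prim g (picard_rhs F a b z)).
  set (zn := fun n => Nat.iter n S (fun _ => g)).
  assert (Hzn : forall n t, continuous (zn n) t).
  { intros [|n] t; [apply continuous_const |].
    unfold zn; simpl. unfold S at 1. apply continuous_prim.
    apply continuous_picard_rhs; [easy |].
    induction n as [|n IH]; simpl; [intros s; apply continuous_const |].
    intros s. unfold S at 1. apply continuous_prim. now apply continuous_picard_rhs. }
  (* Each summand has a task: 1 lets the weight absorb the integrations giving [y] and [x], [6 * L]
     yields the contraction, and the last term bounds the first Picard step by [e]. *)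
  set (k := fun t => 1 + (6 * L t + Rabs (picard_rhs F a b (fun _ => g) t))).
  assert (Hkc : forall t, continuous k t).
  { intros t. unfold k. apply (continuous_plus (fun _ => 1)); [apply continuous_const |].
    apply (continuous_plus (fun s => 6 * L s)).
    - now apply (continuous_scal_r 6 L).
    - apply continuous_Rabs_comp. apply continuous_picard_rhs; [easy |].
      intros s; apply continuous_const. }
  set (e := fun t => exp (prim 0 k t)).
  assert (Hpos : forall t, 0 < e t) by (intros; apply exp_pos).
  assert (He : forall t, is_derive e t (k t * e t)).
  { intros t. unfold e. apply (is_derive_comp exp (prim 0 k) t).
    - apply is_derive_exp.
    - now apply is_derive_prim. }
  assert (Hk : forall s, 0 <= s -> 1 <= k s /\ 0 <= L s /\ 6 * L s <= k s).
  { intros s Hs. specialize (HL0 s Hs). unfold k.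
    assert (P := Rabs_pos (picard_rhs F a b (fun _ => g) s)). lra. }
  assert (Hstep : forall n t, 0 <= t ->
    Rabs (zn (Datatypes.S n) t - zn n t) <= (/ 2) ^ n * e t).
  { induction n as [|n IH]; intros t Ht.
    (* The constant starting function is written as a primitive of 0, so that the first step is a
       distance of primitives. *)
    - replace (zn 0%nat t) with (prim g (fun _ => 0) t)
        by (unfold prim; rewrite RInt_const; unfold scal, zn; simpl; unfold mult; simpl; ring).
      change (Rabs (prim g (picard_rhs F a b (fun _ => g)) t - prim g (fun _ => 0) t)
        <= 1 * e t).
      apply (prim_dist g _ _ (fun r => 1 * e r) (fun r => 1 * (k r * e r))); auto.
      + apply continuous_picard_rhs; [easy |]. intros s; apply continuous_const.
      + intros s; apply continuous_const.
      + intros s _. apply (is_derive_scal e s 1 (k s * e s)), He.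
      + specialize (Hpos 0). lra.
      + intros s Hs. rewrite Rminus_0_r, Rmult_1_l.
        assert (E1 : 1 <= e s).
        { enough (0 <= prim 0 k s) by
            (assert (Q := exp_ineq1_le (prim 0 k s)); unfold e; lra).
          assert (Q := increment_le (fun _ => 0) (prim 0 k) (fun _ => 0) k 0 s Hs).
          cbv beta in Q. rewrite prim_0 in Q.
          enough (0 - 0 <= prim 0 k s - 0) by lra. apply Q.
          - intros r _. apply (is_derive_const 0 r).
          - intros r _. now apply is_derive_prim.
          - intros r Hr. destruct (Hk r); lra. }
        destruct (Hk s Hs) as [H1 [H2 H3]].
        assert (Rabs (picard_rhs F a b (fun _ => g) s) <= k s) by (unfold k; lra).
        nra.
    - replace ((/ 2) ^ Datatypes.S n) with ((/ 2) ^ n / 2) by (simpl; field).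
      apply (picard_contraction F L k e a b g (zn (Datatypes.S n)) (zn n)); auto.
      apply pow_le. lra. }
  (* The factor of [e t] is the sum of [(/ 2) ^ i] over n <= i < n + m. *)
  assert (Hdist : forall n m t, 0 <= t ->
    Rabs (zn (n + m)%nat t - zn n t) <= (2 * (/ 2) ^ n - 2 * (/ 2) ^ (n + m)) * e t).
  { intros n m t Ht. induction m as [|m IH].
    - rewrite Nat.add_0_r, !Rminus_diag, Rabs_R0. lra.
    - rewrite Nat.add_succ_r.
      replace (zn (Datatypes.S (n + m)) t - zn n t) with
        ((zn (Datatypes.S (n + m)) t - zn (n + m)%nat t) + (zn (n + m)%nat t - zn n t))
        by ring.
      eapply Rle_trans; [apply Rabs_triang |].
      specialize (Hstep (n + m)%nat t Ht). simpl pow. lra. }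
  assert (Hpow : is_lim_seq (fun n => 2 * (/ 2) ^ n) 0).
  { replace 0 with (2 * 0) by ring. apply (is_lim_seq_scal_l _ 2 0).
    apply is_lim_seq_geom. rewrite Rabs_right; lra. }
  assert (Hp0 : forall n, 0 < (/ 2) ^ n) by (intros; apply pow_lt; lra).
  assert (Hsmall : forall eps, 0 < eps -> exists N, forall n, (N <= n)%nat ->
    2 * (/ 2) ^ n < eps).
  { intros eps Heps. apply is_lim_seq_spec in Hpow.
    destruct (Hpow (mkposreal eps Heps)) as [N HN]. exists N. intros n Hn.
    specialize (HN n Hn). simpl in HN. apply Rabs_lt_between in HN. lra. }
  set (zl := fun t => real (Lim_seq (fun n => zn n t))).
  assert (Hlim : forall t, 0 <= t -> is_lim_seq (fun n => zn n t) (zl t)).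
  { intros t Ht. apply Lim_seq_correct'. apply ex_lim_seq_cauchy_corr.
    intros eps. specialize (Hpos t).
    destruct (Hsmall (eps / 2 / e t)) as [N HN].
    { assert (P := cond_pos eps). apply Rdiv_lt_0_compat; lra. }
    exists N. specialize (HN N (Nat.le_refl N)).
    apply (Rmult_lt_compat_r (e t)) in HN; [| easy].
    replace (eps / 2 / e t * e t) with (eps / 2) in HN by (field; lra).
    assert (Q : forall n, (N <= n)%nat -> Rabs (zn n t - zn N t) < eps / 2).
    { intros n Hn. replace n with (N + (n - N))%nat by
        (rewrite Nat.add_comm; now apply Nat.sub_add).
      eapply Rle_lt_trans; [now apply Hdist |].
      specialize (Hp0 (N + (n - N))%nat). nra. }
    intros n m Hn Hm. specialize (Q n Hn) as Qn. specialize (Q m Hm) as Qm.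
    apply Rabs_lt_between in Qn, Qm. apply Rabs_lt_between. lra. }
  assert (Hzl : forall n t, 0 <= t -> Rabs (zn n t - zl t) <= 2 * (/ 2) ^ n * e t).
  { intros n t Ht.
    assert (Q : Rbar_le (Rabs (zl t - zn n t)) (2 * (/ 2) ^ n * e t)).
    { apply (is_lim_seq_le (fun m => Rabs (zn (n + m)%nat t - zn n t))
               (fun _ => 2 * (/ 2) ^ n * e t)).
      - intros m. eapply Rle_trans; [now apply Hdist |].
        specialize (Hp0 (n + m)%nat). specialize (Hpos t). nra.
      - apply (is_lim_seq_abs _ (zl t - zn n t)).
        apply is_lim_seq_minus'; [| apply is_lim_seq_const].
        apply (is_lim_seq_ext (fun m => zn (m + n)%nat t)).
        + intros m. now rewrite Nat.add_comm.
        + apply (is_lim_seq_incr_n (fun m => zn m t) n). now apply Hlim.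
      - apply is_lim_seq_const. }
    simpl in Q. now rewrite Rabs_minus_sym. }
  (* The limit is controlled for t >= 0 only. Freezing it at its value in 0 for negative times gives
     a function continuous on the whole line, as its primitives require. *)
  set (zp := fun t => zl (Rmax 0 t)).
  assert (Hzpn : forall n t, 0 <= t -> Rabs (zn n t - zp t) <= 2 * (/ 2) ^ n * e t).
  { intros n t Ht. unfold zp. rewrite Rmax_right by lra. now apply Hzl. }
  assert (Hmaxc : forall t, continuous (fun s => Rmax 0 s) t).
  { intros t. apply (continuous_Rmax (fun _ => 0) (fun s => s)).
    - apply continuous_const.
    - apply continuous_id. }
  assert (Hzpc : forall t, continuous zp t).
  { intros t. apply continuity_pt_filterlim.
    apply (CVU_continuity (fun n s => zn n (Rmax 0 s)) zp t (mkposreal 1 Rlt_0_1)).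
    (* The weight is nondecreasing on [0,oo), so [M] bounds it on the ball of radius 1 around [t]
       and the convergence is uniform there. *)
    - intros eps Heps. set (M := e (Rmax 0 (t + 1))).
      assert (HM : 0 < M) by apply Hpos.
      destruct (Hsmall (eps / M)) as [N HN]; [now apply Rdiv_lt_0_compat |].
      exists N. intros n s Hn Hs. unfold Boule in Hs; simpl in Hs.
      apply Rabs_lt_between in Hs. rewrite Rabs_minus_sym.
      eapply Rle_lt_trans; [apply Hzl, Rmax_l |].
      specialize (HN n Hn). apply (Rmult_lt_compat_r M) in HN; [| easy].
      replace (eps / M * M) with eps in HN by (field; lra).
      apply Rle_lt_trans with (2 := HN). specialize (Hp0 n).
      apply Rmult_le_compat_l; [lra |]. unfold M.
      assert (HR : Rmax 0 s <= Rmax 0 (t + 1)) by (apply Rle_max_compat_l; lra).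
      assert (Q := increment_le (fun _ => 0) e (fun _ => 0) (fun r => k r * e r)
                     (Rmax 0 s) (Rmax 0 (t + 1)) HR).
      cbv beta in Q. enough (0 - 0 <= e (Rmax 0 (t + 1)) - e (Rmax 0 s)) by lra.
      apply Q; auto.
      + intros r _. apply (is_derive_const 0 r).
      + intros r Hr. assert (P := Rmax_l 0 s). destruct (Hk r ltac:(lra)).
        specialize (Hpos r). nra.
    - intros n s _. apply continuity_pt_filterlim.
      apply (continuous_comp (fun s => Rmax 0 s) (zn n)); auto.
    - unfold Boule. rewrite Rminus_diag, Rabs_R0. apply Rlt_0_1. }
  assert (Hfix : forall t, 0 <= t -> S zp t = zp t).
  { intros t Ht.
    assert (Q : forall n, Rabs (S zp t - zp t) <= 2 * (/ 2) ^ n * e t).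
    { intros n.
      assert (A := picard_contraction F L k e a b g (zn n) zp (2 * (/ 2) ^ n) t HFc HFl Hk
        (fun s _ => He s) Hpos (Hzn n) Hzpc ltac:(specialize (Hp0 n); lra)
        (Hzpn n) Ht).
      change (Rabs (zn (Datatypes.S n) t - S zp t) <= 2 * (/ 2) ^ n / 2 * e t) in A.
      assert (B := Hzpn (Datatypes.S n) t Ht). simpl pow in B.
      apply Rabs_le_between in A, B. apply Rabs_le_between.
      lra. }
    assert (Z : Rbar_le (Rabs (S zp t - zp t)) (0 * e t)).
    { apply (is_lim_seq_le (fun _ => Rabs (S zp t - zp t)) (fun n => 2 * (/ 2) ^ n * e t));
        auto; [apply is_lim_seq_const |].
      apply (is_lim_seq_scal_r _ (e t) 0), Hpow. }
    simpl in Z. rewrite Rmult_0_l in Z.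
    assert (P := Rabs_pos (S zp t - zp t)).
    apply Rminus_diag_uniq. apply Rabs_eq_0. lra. }
  (* [S zp] rather than [zp] is the witness: the two agree for t >= 0, but [S zp] is a primitive and
     so has a two-sided derivative at 0. *)
  exists (prim a (prim b zp)), (prim b zp), (S zp).
  split; [apply prim_0 |]. split; [apply prim_0 |]. split; [apply prim_0 |].
  intros t Ht. rewrite (Hfix t Ht). split; [| split].
  - apply is_derive_prim. intros s. now apply continuous_prim.
  - now apply is_derive_prim.
  - apply (is_derive_prim g (picard_rhs F a b zp)). now apply continuous_picard_rhs.
Qed.

(** * The truncated equation *)

(** Gronwall for the squared Euclidean distance [E], which is differentiable where absolute values
    are not. In the rate, 2 comes from the products of consecutive differences and [4 * L] from the
    Lipschitz bound. The abstract third derivatives let the estimate serve both the truncated and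
    the original equation. *)
Lemma ode_dist (x1 y1 z1 w1 x2 y2 z2 w2 : R -> R) (L T : R) :
  0 <= L ->
  (forall t, 0 <= t <= T ->
     is_derive x1 t (y1 t) /\ is_derive y1 t (z1 t) /\ is_derive z1 t (w1 t)) ->
  (forall t, 0 <= t <= T ->
     is_derive x2 t (y2 t) /\ is_derive y2 t (z2 t) /\ is_derive z2 t (w2 t)) ->
  (forall t, 0 <= t <= T ->
     Rabs (w1 t - w2 t) <=
       L * (Rabs (x1 t - x2 t) + Rabs (y1 t - y2 t) + Rabs (z1 t - z2 t))) ->
  x1 0 = x2 0 -> y1 0 = y2 0 ->
  forall t, 0 <= t <= T ->
    Rabs (x1 t - x2 t) <= Rabs (z1 0 - z2 0) * exp ((2 + 4 * L) * T) /\
    Rabs (y1 t - y2 t) <= Rabs (z1 0 - z2 0) * exp ((2 + 4 * L) * T) /\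
    Rabs (z1 t - z2 t) <= Rabs (z1 0 - z2 0) * exp ((2 + 4 * L) * T).
Proof.
  intros HL H1 H2 Hw Hx0 Hy0 t Ht.
  set (E := fun s => (x1 s - x2 s) * (x1 s - x2 s) + (y1 s - y2 s) * (y1 s - y2 s)
                   + (z1 s - z2 s) * (z1 s - z2 s)).
  set (dE := fun s => 2 * ((x1 s - x2 s) * (y1 s - y2 s)) +
      2 * ((y1 s - y2 s) * (z1 s - z2 s)) + 2 * ((z1 s - z2 s) * (w1 s - w2 s))).
  assert (HE : E t <= E 0 * exp ((2 + 4 * L) * (t - 0))).
  { apply (gronwall_upper E dE); [lra | |].
    - intros s Hs. destruct (H1 s ltac:(lra)) as [a1 [b1 c1]].
      destruct (H2 s ltac:(lra)) as [a2 [b2 c2]].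
      assert (D : forall u v du dv, is_derive u s du -> is_derive v s dv ->
        is_derive (fun r : R => (u r - v r) * (u r - v r)) s (2 * ((u s - v s) * (du - dv)))).
      { intros u v du dv Hu Hv.
        assert (Hd : is_derive (fun r : R => u r - v r) s (du - dv))
          by now apply (is_derive_minus u v).
        replace (2 * ((u s - v s) * (du - dv)))
          with ((du - dv) * (u s - v s) + (u s - v s) * (du - dv)) by ring.
        apply (is_derive_mult (fun r : R => u r - v r) (fun r : R => u r - v r) s); auto.
        intros; apply Rmult_comm. }
      unfold E, dE.
      apply (is_derive_plus (fun r => (x1 r - x2 r) * (x1 r - x2 r)
                                      + (y1 r - y2 r) * (y1 r - y2 r))
              (fun r => (z1 r - z2 r) * (z1 r - z2 r)) s).
      + apply (is_derive_plus (fun r => (x1 r - x2 r) * (x1 r - x2 r))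
                              (fun r => (y1 r - y2 r) * (y1 r - y2 r)) s); now apply D.
      + now apply D.
    - intros s Hs. specialize (Hw s ltac:(lra)). unfold E, dE.
      set (p := x1 s - x2 s) in *. set (q := y1 s - y2 s) in *.
      set (r := z1 s - z2 s) in *. set (w := w1 s - w2 s) in *.
      assert (A : r * w <= L * (Rabs r * (Rabs p + Rabs q + Rabs r))).
      { eapply Rle_trans; [apply Rle_abs |]. rewrite Rabs_mult.
        apply Rle_trans with (Rabs r * (L * (Rabs p + Rabs q + Rabs r))); [| lra].
        apply Rmult_le_compat_l; [apply Rabs_pos | easy]. }
      assert (B : Rabs r * (Rabs p + Rabs q + Rabs r) <= 2 * (p * p + q * q + r * r)).
      { assert (Sq : forall v, Rabs v * Rabs v = v * v).
        { intros v. rewrite <- Rabs_mult. apply Rabs_right. nra. }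
        rewrite <- (Sq p), <- (Sq q), <- (Sq r).
        generalize (Rabs p) (Rabs q) (Rabs r). intros p' q' r'.
        assert (S1 := pow2_ge_0 (p' - r')). assert (S2 := pow2_ge_0 (q' - r')).
        assert (S3 := pow2_ge_0 p'). assert (S4 := pow2_ge_0 q'). nra. }
      assert (C : L * (Rabs r * (Rabs p + Rabs q + Rabs r)) <=
                  L * (2 * (p * p + q * q + r * r))) by now apply Rmult_le_compat_l.
      assert (S1 := pow2_ge_0 (p - q)). assert (S2 := pow2_ge_0 (q - r)).
      assert (S3 := pow2_ge_0 p). assert (S4 := pow2_ge_0 r). lra. }
  assert (E0 : E 0 = Rabs (z1 0 - z2 0) * Rabs (z1 0 - z2 0)).
  { unfold E. rewrite Hx0, Hy0. rewrite <- Rabs_mult.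
    rewrite (Rabs_right ((z1 0 - z2 0) * (z1 0 - z2 0))) by apply Rle_ge, Rle_0_sqr. ring. }
  set (c := exp ((2 + 4 * L) * T)).
  assert (Hc1 : 1 <= c).
  { unfold c. assert (Q := exp_ineq1_le ((2 + 4 * L) * T)). nra. }
  assert (Hc : exp ((2 + 4 * L) * (t - 0)) <= c).
  { unfold c. destruct (Req_dec t T) as [->|Hn]; [right; f_equal; ring |].
    apply Rlt_le, exp_increasing. nra. }
  assert (HR : E t <= (Rabs (z1 0 - z2 0) * c) * (Rabs (z1 0 - z2 0) * c)).
  { rewrite E0 in HE. set (g := Rabs (z1 0 - z2 0)) in *.
    assert (0 <= g * g) by nra.
    apply Rle_trans with (1 := HE). apply Rle_trans with (g * g * c).
    - now apply Rmult_le_compat_l.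
    - assert (g * g * c <= g * g * c * c) by (assert (0 <= g * g * c) by nra; nra). lra. }
  assert (P : 0 <= Rabs (z1 0 - z2 0) * c)
    by (apply Rmult_le_pos; [apply Rabs_pos | lra]).
  set (m := Rabs (z1 0 - z2 0) * c) in *.
  assert (K : forall v, v * v <= m * m -> Rabs v <= m).
  { intros v Hv. rewrite <- (Rabs_right m) by lra. now apply Rsqr_le_abs_0. }
  assert (S1 := Rle_0_sqr (x1 t - x2 t)). assert (S2 := Rle_0_sqr (y1 t - y2 t)).
  assert (S3 := Rle_0_sqr (z1 t - z2 t)). unfold Rsqr in S1, S2, S3. unfold E in HR.
  repeat split; apply K; lra.
Qed.

(** * Clamping, the truncated right-hand side and its global solutions *)

Definition clamp (lo hi v : R) : R := Rmax lo (Rmin hi v).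

Lemma clamp_bounds lo hi v : lo <= hi -> lo <= clamp lo hi v <= hi.
Proof. unfold clamp, Rmax, Rmin. repeat destruct Rle_dec; lra. Qed.

Lemma clamp_id lo hi v : lo <= v <= hi -> clamp lo hi v = v.
Proof. unfold clamp, Rmax, Rmin. repeat destruct Rle_dec; lra. Qed.

Lemma clamp_lipschitz lo hi u v : Rabs (clamp lo hi u - clamp lo hi v) <= Rabs (u - v).
Proof.
  unfold clamp, Rmax, Rmin, Rabs.
  repeat destruct Rle_dec; repeat destruct Rcase_abs; lra.
Qed.

Lemma continuous_clamp (lo hi v : R -> R) t :
  continuous lo t -> continuous hi t -> continuous v t ->
  continuous (fun s => clamp (lo s) (hi s) (v s)) t.
Proof.
  intros. apply continuous_Rmax; [easy |]. now apply continuous_Rmin.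
Qed.

Definition rhs (lambda x y z : R) : R :=
  2 * lambda * (y - 1) * y - (1 + lambda) * x * z.

(** The quadratic in y contributes the factor [y + y' - 1], and x z - x' z' is split as x (z - z') +
    (x - x') z'; this is why the bounds concern exactly [x], [y + y' - 1] and [z']. *)
Lemma rhs_lipschitz lambda N Y Z x y z x' y' z' :
  0 < lambda -> Rabs x <= N -> Rabs (y + y' - 1) <= Y -> Rabs z' <= Z ->
  Rabs (rhs lambda x y z - rhs lambda x' y' z') <=
    ((1 + lambda) * (N + Z) + 2 * lambda * Y) *
      (Rabs (x - x') + Rabs (y - y') + Rabs (z - z')).
Proof.
  intros Hl Hx Hy Hz.
  replace (rhs lambda x y z - rhs lambda x' y' z') with
    (2 * lambda * ((y + y' - 1) * (y - y')) -
       (1 + lambda) * (x * (z - z') + (x - x') * z')) by (unfold rhs; ring).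
  assert (A : Rabs ((y + y' - 1) * (y - y')) <= Y * Rabs (y - y')).
  { rewrite Rabs_mult. apply Rmult_le_compat_r; [apply Rabs_pos | easy]. }
  assert (B : Rabs (x * (z - z')) <= N * Rabs (z - z')).
  { rewrite Rabs_mult. apply Rmult_le_compat_r; [apply Rabs_pos | easy]. }
  assert (C : Rabs ((x - x') * z') <= Z * Rabs (x - x')).
  { rewrite Rabs_mult, Rmult_comm. apply Rmult_le_compat_r; [apply Rabs_pos | easy]. }
  assert (Hx0 := Rabs_pos x). assert (Hy0 := Rabs_pos (y + y' - 1)).
  assert (Hz0 := Rabs_pos z').
  assert (Px := Rabs_pos (x - x')). assert (Py := Rabs_pos (y - y')).
  assert (Pz := Rabs_pos (z - z')).
  set (dx := Rabs (x - x')) in *. set (dy := Rabs (y - y')) in *.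
  set (dz := Rabs (z - z')) in *.
  apply Rle_trans with (2 * lambda * (Y * dy) + (1 + lambda) * (N * dz + Z * dx)).
  - apply Rabs_le_between in A, B, C. apply Rabs_le. split; nra.
  - assert (0 <= 2 * lambda * Y * (dx + dz)) by (repeat apply Rmult_le_pos; lra).
    assert (0 <= (1 + lambda) * (N * (dx + dy) + Z * (dy + dz)));
      [| lra].
    apply Rmult_le_pos; [lra |].
    apply Rplus_le_le_0_compat; apply Rmult_le_pos; lra.
Qed.

(** A slope between 0 and beta gives |f| <= |alpha| + beta t for t >= 0. Replacing t by the larger 1
    + t^2 keeps the bound positive at negative times too. *)
Definition xbound (alpha beta t : R) : R := Rabs alpha + beta + beta * t ^ 2.

(* Chosen so that [zbound' = (1 + lambda) * xbound * zbound]. *)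
Definition zbound (lambda alpha beta G t : R) : R :=
  G * exp ((1 + lambda) * ((Rabs alpha + beta) * t + beta * (t ^ 3 / 3))).

(* Globally Lipschitz on bounded time intervals; the clamps are inactive along the
   solutions with [1 <= f'] and [f'' <= 0]. *)
Definition trunc (lambda alpha beta G t x y z : R) : R :=
  rhs lambda (clamp (- xbound alpha beta t) (xbound alpha beta t) x)
    (clamp 1 beta y) (clamp (- zbound lambda alpha beta G t) 0 z).

Lemma xbound_pos alpha beta t : 1 < beta -> 0 < xbound alpha beta t.
Proof.
  intros Hb. unfold xbound. assert (P := Rabs_pos alpha).
  assert (0 <= beta * t ^ 2) by (apply Rmult_le_pos; nra). lra.
Qed.

Lemma xbound_increasing alpha beta s t :
  1 < beta -> 0 <= s <= t -> xbound alpha beta s <= xbound alpha beta t.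
Proof.
  intros Hb Hs. unfold xbound. apply Rplus_le_compat_l, Rmult_le_compat_l; nra.
Qed.

Lemma zbound_pos lambda alpha beta G t : 0 < G -> 0 < zbound lambda alpha beta G t.
Proof. intros HG. apply Rmult_lt_0_compat; [easy | apply exp_pos]. Qed.

Lemma is_derive_zbound lambda alpha beta G t :
  is_derive (zbound lambda alpha beta G) t
    ((1 + lambda) * xbound alpha beta t * zbound lambda alpha beta G t).
Proof. unfold zbound, xbound. auto_derive; [easy |]. unfold Rdiv. simpl pow. field. Qed.

Lemma continuous_xbound alpha beta t : continuous (xbound alpha beta) t.
Proof.
  apply (is_derive_continuous _ _ (2 * beta * t)).
  unfold xbound. auto_derive; [easy | ring].
Qed.

Lemma continuous_zbound lambda alpha beta G t :
  continuous (zbound lambda alpha beta G) t.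
Proof. eapply is_derive_continuous, is_derive_zbound. Qed.

Lemma continuous_rhs_trunc lambda alpha beta G :
  continuous_rhs (trunc lambda alpha beta G).
Proof.
  intros x y z Hx Hy Hz t. unfold trunc, rhs.
  assert (CX := continuous_clamp (fun s => - xbound alpha beta s) (xbound alpha beta) x t
    (continuous_opp (xbound alpha beta) t (continuous_xbound alpha beta t))
    (continuous_xbound alpha beta t) (Hx t)).
  assert (CY := continuous_clamp (fun _ => 1) (fun _ => beta) y t
    (continuous_const _ _) (continuous_const _ _) (Hy t)).
  assert (CZ := continuous_clamp (fun s => - zbound lambda alpha beta G s) (fun _ => 0) z t
    (continuous_opp (zbound lambda alpha beta G) t (continuous_zbound lambda alpha beta G t))
    (continuous_const _ _) (Hz t)).
  cbv beta in CX, CY, CZ.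
  apply (continuous_minus
    (fun s => 2 * lambda * (clamp 1 beta (y s) - 1) * clamp 1 beta (y s))
    (fun s => (1 + lambda) * clamp (- xbound alpha beta s) (xbound alpha beta s) (x s) *
                clamp (- zbound lambda alpha beta G s) 0 (z s))).
  - apply (continuous_mult (fun s => 2 * lambda * (clamp 1 beta (y s) - 1))
             (fun s => clamp 1 beta (y s))); [| easy].
    apply (continuous_mult (fun s => 2 * lambda) (fun s => clamp 1 beta (y s) - 1));
      [apply continuous_const |].
    apply (continuous_minus (fun s => clamp 1 beta (y s)) (fun _ => 1));
      [easy | apply continuous_const].
  - apply (continuous_mult
      (fun s => (1 + lambda) * clamp (- xbound alpha beta s) (xbound alpha beta s) (x s))
      (fun s => clamp (- zbound lambda alpha beta G s) 0 (z s))); [| easy].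
    apply (continuous_mult (fun s => 1 + lambda)
      (fun s => clamp (- xbound alpha beta s) (xbound alpha beta s) (x s)));
      [apply continuous_const | easy].
Qed.

Definition trunc_lip (lambda alpha beta G t : R) : R :=
  (1 + lambda) * (xbound alpha beta t + zbound lambda alpha beta G t)
    + 2 * lambda * (2 * beta).

Lemma trunc_lip_pos lambda alpha beta G t :
  0 < lambda -> 1 < beta -> 0 < G -> 0 <= trunc_lip lambda alpha beta G t.
Proof.
  intros Hl Hb HG. unfold trunc_lip.
  assert (A := xbound_pos alpha beta t Hb).
  assert (B := zbound_pos lambda alpha beta G t HG). nra.
Qed.

Lemma continuous_trunc_lip lambda alpha beta G t :
  continuous (trunc_lip lambda alpha beta G) t.
Proof.
  unfold trunc_lip.
  apply (continuous_plus
    (fun s => (1 + lambda) * (xbound alpha beta s + zbound lambda alpha beta G s))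
    (fun _ => 2 * lambda * (2 * beta))); [| apply continuous_const].
  apply (continuous_scal_r (1 + lambda)
    (fun s => xbound alpha beta s + zbound lambda alpha beta G s)).
  apply (continuous_plus (xbound alpha beta) (zbound lambda alpha beta G));
    [apply continuous_xbound | apply continuous_zbound].
Qed.

Lemma lipschitz_rhs_trunc lambda alpha beta G :
  0 < lambda -> 1 < beta -> 0 < G ->
  lipschitz_rhs (trunc lambda alpha beta G) (trunc_lip lambda alpha beta G).
Proof.
  intros Hl Hb HG t x y z x' y' z' _. unfold trunc.
  assert (A := xbound_pos alpha beta t Hb).
  assert (B := zbound_pos lambda alpha beta G t HG).
  eapply Rle_trans.
  - apply (rhs_lipschitz lambda (xbound alpha beta t) (2 * beta)
             (zbound lambda alpha beta G t)); auto.
    + apply Rabs_le, clamp_bounds. lra.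
    + assert (C := clamp_bounds 1 beta y ltac:(lra)).
      assert (D := clamp_bounds 1 beta y' ltac:(lra)). apply Rabs_le. lra.
    + assert (C := clamp_bounds (- zbound lambda alpha beta G t) 0 z' ltac:(lra)).
      apply Rabs_le. lra.
  - apply Rmult_le_compat_l; [now apply trunc_lip_pos |].
    repeat apply Rplus_le_compat; apply clamp_lipschitz.
Qed.

Definition ode_solution (F : R -> R -> R -> R -> R) (x y z : R -> R) : Prop :=
  forall t, 0 <= t ->
    is_derive x t (y t) /\ is_derive y t (z t) /\
    is_derive z t (F t (x t) (y t) (z t)).

(** [G] fixes the truncation separately from the initial curvature [gamma], so that all shots with
    the same [G] solve one equation and can be compared. *)
Definition shot (lambda alpha beta G gamma : R) (x y z : R -> R) : Prop :=
  x 0 = alpha /\ y 0 = beta /\ z 0 = gamma /\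
  ode_solution (trunc lambda alpha beta G) x y z.

Lemma shot_exists lambda alpha beta G gamma :
  0 < lambda -> 1 < beta -> 0 < G ->
  exists x y z, shot lambda alpha beta G gamma x y z.
Proof.
  intros Hl Hb HG.
  apply (picard (trunc lambda alpha beta G) (trunc_lip lambda alpha beta G)).
  - apply continuous_trunc_lip.
  - apply continuous_rhs_trunc.
  - now apply lipschitz_rhs_trunc.
  - intros t _. now apply trunc_lip_pos.
Qed.

(** The maximum of the Lipschitz constant over [0, T] makes [C] uniform in the shots, whence
    continuous dependence on the initial curvature. *)
Lemma shot_dist lambda alpha beta G T :
  0 < lambda -> 1 < beta -> 0 < G -> 0 <= T ->
  exists C, 0 < C /\ forall g1 x1 y1 z1 g2 x2 y2 z2,
    shot lambda alpha beta G g1 x1 y1 z1 -> shot lambda alpha beta G g2 x2 y2 z2 ->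
    forall t, 0 <= t <= T ->
      Rabs (y1 t - y2 t) <= Rabs (g1 - g2) * C /\
      Rabs (z1 t - z2 t) <= Rabs (g1 - g2) * C.
Proof.
  intros Hl Hb HG HT.
  destruct (continuity_ab_maj (trunc_lip lambda alpha beta G) 0 T HT) as [m [Hm _]].
  { intros c _. apply continuity_pt_filterlim, continuous_trunc_lip. }
  set (L := trunc_lip lambda alpha beta G m).
  exists (exp ((2 + 4 * L) * T)). split; [apply exp_pos |].
  intros g1 x1 y1 z1 g2 x2 y2 z2 [X1 [Y1 [Z1 S1]]] [X2 [Y2 [Z2 S2]]] t Ht.
  rewrite <- Z1, <- Z2.
  apply (ode_dist x1 y1 z1 (fun s => trunc lambda alpha beta G s (x1 s) (y1 s) (z1 s))
    x2 y2 z2 (fun s => trunc lambda alpha beta G s (x2 s) (y2 s) (z2 s)) L T);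
    auto; try congruence.
  - now apply trunc_lip_pos.
  - intros s Hs. apply S1. lra.
  - intros s Hs. apply S2. lra.
  - intros s Hs. eapply Rle_trans.
    + apply lipschitz_rhs_trunc; auto; lra.
    + apply Rmult_le_compat_r; [| now apply Hm].
      repeat apply Rplus_le_le_0_compat; apply Rabs_pos.
Qed.

(** * Shooting *)

(** Both kinds of exit record the history up to [T]. This makes them mutually exclusive, and the
    strict inequalities on a compact interval make them stable. *)
Definition convex_exit (y z : R -> R) : Prop :=
  exists T, 0 <= T /\ 0 < z T /\ forall s, 0 <= s <= T -> 1 < y s.

Definition low_exit (y z : R -> R) : Prop :=
  exists T, 0 <= T /\ y T < 1 /\ forall s, 0 <= s <= T -> z s < 0.

Lemma exits_exclusive y z : convex_exit y z -> low_exit y z -> False.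
Proof.
  intros [T [HT [Hz Hy]]] [T' [HT' [Hy' Hz']]].
  destruct (Rle_lt_dec T T').
  - specialize (Hz' T). lra.
  - specialize (Hy T'). lra.
Qed.

Lemma shot_continuous lambda alpha beta G gamma x y z t :
  shot lambda alpha beta G gamma x y z -> 0 <= t -> continuous y t /\ continuous z t.
Proof.
  intros [_ [_ [_ S]]] Ht. destruct (S t Ht) as [_ [Dy Dz]].
  split; eapply is_derive_continuous; eassumption.
Qed.

Lemma positive_lower_bound (p : R -> R) (T : R) :
  0 <= T -> (forall t, 0 <= t <= T -> continuous p t) ->
  (forall t, 0 <= t <= T -> 0 < p t) ->
  exists eps, 0 < eps /\ forall t, 0 <= t <= T -> eps <= p t.
Proof.
  intros HT Hc Hp. destruct (continuity_ab_min p 0 T HT) as [m [Hm Hmt]].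
  - intros c Hc'. apply continuity_pt_filterlim. now apply Hc.
  - exists (p m). auto.
Qed.

(** By compactness the inequalities hold with a positive margin on [0, T]; dividing the margin by
    the constant of [shot_dist] gives an admissible radius. *)
Lemma convex_exit_open lambda alpha beta G g x y z :
  0 < lambda -> 1 < beta -> 0 < G ->
  shot lambda alpha beta G g x y z -> convex_exit y z ->
  exists d, 0 < d /\ forall g' x' y' z', shot lambda alpha beta G g' x' y' z' ->
    Rabs (g' - g) < d -> convex_exit y' z'.
Proof.
  intros Hl Hb HG S [T [HT [Hz Hy]]].
  destruct (positive_lower_bound (fun s => y s - 1) T HT) as [eps [Heps Hy']].
  { intros t Ht. apply (continuous_minus y (fun _ => 1)); [| apply continuous_const].
    exact (proj1 (shot_continuous _ _ _ _ _ _ _ _ t S ltac:(lra))). }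
  { intros t Ht. specialize (Hy t Ht). lra. }
  destruct (shot_dist lambda alpha beta G T Hl Hb HG HT) as [C [HC HD]].
  assert (Hm : 0 < Rmin (z T) eps) by now apply Rmin_glb_lt.
  exists (Rmin (z T) eps / C). split; [now apply Rdiv_lt_0_compat |].
  intros g' x' y' z' S' Hg. apply (Rmult_lt_compat_r C) in Hg; [| easy].
  replace (Rmin (z T) eps / C * C) with (Rmin (z T) eps) in Hg by (field; lra).
  assert (H1 := Rmin_l (z T) eps). assert (H2 := Rmin_r (z T) eps).
  exists T. split; [easy | split].
  - destruct (HD _ _ _ _ _ _ _ _ S' S T ltac:(lra)) as [_ D].
    assert (Q : Rabs (z' T - z T) < z T) by lra. apply Rabs_lt_between in Q. lra.
  - intros s Hs. destruct (HD _ _ _ _ _ _ _ _ S' S s Hs) as [D _].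
    specialize (Hy' s Hs). cbv beta in Hy'.
    assert (Q : Rabs (y' s - y s) < eps) by lra. apply Rabs_lt_between in Q. lra.
Qed.

Lemma low_exit_open lambda alpha beta G g x y z :
  0 < lambda -> 1 < beta -> 0 < G ->
  shot lambda alpha beta G g x y z -> low_exit y z ->
  exists d, 0 < d /\ forall g' x' y' z', shot lambda alpha beta G g' x' y' z' ->
    Rabs (g' - g) < d -> low_exit y' z'.
Proof.
  intros Hl Hb HG S [T [HT [Hy Hz]]].
  destruct (positive_lower_bound (fun s => - z s) T HT) as [eps [Heps Hz']].
  { intros t Ht. apply (continuous_opp z).
    exact (proj2 (shot_continuous _ _ _ _ _ _ _ _ t S ltac:(lra))). }
  { intros t Ht. specialize (Hz t Ht). lra. }
  destruct (shot_dist lambda alpha beta G T Hl Hb HG HT) as [C [HC HD]].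
  assert (Hm : 0 < Rmin (1 - y T) eps) by (apply Rmin_glb_lt; lra).
  exists (Rmin (1 - y T) eps / C). split; [now apply Rdiv_lt_0_compat |].
  intros g' x' y' z' S' Hg. apply (Rmult_lt_compat_r C) in Hg; [| easy].
  replace (Rmin (1 - y T) eps / C * C) with (Rmin (1 - y T) eps) in Hg by (field; lra).
  assert (H1 := Rmin_l (1 - y T) eps). assert (H2 := Rmin_r (1 - y T) eps).
  exists T. split; [easy | split].
  - destruct (HD _ _ _ _ _ _ _ _ S' S T ltac:(lra)) as [D _].
    assert (Q : Rabs (y' T - y T) < 1 - y T) by lra. apply Rabs_lt_between in Q. lra.
  - intros s Hs. destruct (HD _ _ _ _ _ _ _ _ S' S s Hs) as [_ D].
    specialize (Hz' s Hs). cbv beta in Hz'.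
    assert (Q : Rabs (z' s - z s) < eps) by lra. apply Rabs_lt_between in Q. lra.
Qed.

(** At z = 0 the term containing x vanishes, and clamping to [1, beta] keeps a value y > 1 above
    1. *)
Lemma trunc_inflexion_pos lambda alpha beta G t x y :
  0 < lambda -> 1 < beta -> 0 < G -> 1 < y -> 0 < trunc lambda alpha beta G t x y 0.
Proof.
  intros Hl Hb HG Hy. unfold trunc, rhs.
  rewrite (clamp_id _ 0 0) by (assert (P := zbound_pos lambda alpha beta G t HG); lra).
  assert (1 < clamp 1 beta y) by (unfold clamp, Rmax, Rmin; repeat destruct Rle_dec; lra).
  rewrite Rmult_0_r, Rminus_0_r. apply Rmult_lt_0_compat; [| lra].
  apply Rmult_lt_0_compat; lra.
Qed.

Lemma convex_exit_at lambda alpha beta G g x y z tau :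
  0 < lambda -> 1 < beta -> 0 < G ->
  shot lambda alpha beta G g x y z -> 0 <= tau -> z tau = 0 ->
  (forall s, 0 <= s <= tau -> 1 < y s) -> convex_exit y z.
Proof.
  intros Hl Hb HG S Ht Hz Hy.
  destruct S as [_ [_ [_ S]]]. destruct (S tau Ht) as [_ [Dy Dz]].
  destruct (derive_pos_locally z tau _ Dz) as [d [Hd [Hr _]]].
  { rewrite Hz. apply trunc_inflexion_pos; auto. apply Hy. lra. }
  destruct (continuous_gt_locally y tau 1) as [d' [Hd' Hy']].
  { eapply is_derive_continuous; eassumption. }
  { apply Hy. lra. }
  assert (Hm : 0 < Rmin d d') by now apply Rmin_glb_lt.
  assert (H1 := Rmin_l d d'). assert (H2 := Rmin_r d d').
  exists (tau + Rmin d d' / 2). split; [lra | split].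
  - rewrite <- Hz. apply Hr. lra.
  - intros s Hs. destruct (Rle_lt_dec s tau); [apply Hy; lra |].
    apply Hy', Rabs_lt_between. lra.
Qed.

Lemma low_exit_at lambda alpha beta G g x y z tau :
  shot lambda alpha beta G g x y z -> 0 <= tau -> y tau = 1 ->
  (forall s, 0 <= s <= tau -> z s < 0) -> low_exit y z.
Proof.
  intros S Ht Hy Hz.
  destruct S as [_ [_ [_ S]]]. destruct (S tau Ht) as [_ [Dy Dz]].
  assert (Hzt : z tau < 0) by (apply Hz; lra).
  destruct (derive_pos_locally (fun s => - y s) tau (- z tau)) as [d [Hd [Hr _]]].
  { now apply (is_derive_opp y tau). }
  { lra. }
  destruct (continuous_gt_locally (fun s => - z s) tau 0) as [d' [Hd' Hz']].
  { apply (continuous_opp z). eapply is_derive_continuous; eassumption. }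
  { lra. }
  assert (Hm : 0 < Rmin d d') by now apply Rmin_glb_lt.
  assert (H1 := Rmin_l d d'). assert (H2 := Rmin_r d d').
  exists (tau + Rmin d d' / 2). split; [lra | split].
  - specialize (Hr (tau + Rmin d d' / 2)). lra.
  - intros s Hs. destruct (Rle_lt_dec s tau); [apply Hz; lra |].
    enough (0 < - z s) by lra. apply Hz', Rabs_lt_between. lra.
Qed.

(** The truncated right-hand side vanishes at y = 1, z = 0 for every x, and the clamps are
    1-Lipschitz and fix these two values. The resulting bound is linear in the distance to the
    equilibrium. *)
Lemma trunc_abs_le lambda alpha beta G t x y z :
  0 < lambda -> 1 < beta -> 0 < G ->
  Rabs (trunc lambda alpha beta G t x y z) <=
    2 * lambda * beta * Rabs (y - 1) + (1 + lambda) * xbound alpha beta t * Rabs z.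
Proof.
  intros Hl Hb HG. unfold trunc, rhs.
  assert (N := xbound_pos alpha beta t Hb).
  assert (Z := zbound_pos lambda alpha beta G t HG).
  assert (BX := clamp_bounds (- xbound alpha beta t) (xbound alpha beta t) x ltac:(lra)).
  assert (BY := clamp_bounds 1 beta y ltac:(lra)).
  assert (LY := clamp_lipschitz 1 beta y 1).
  assert (LZ := clamp_lipschitz (- zbound lambda alpha beta G t) 0 z 0).
  rewrite (clamp_id 1 beta 1) in LY by lra.
  rewrite (clamp_id _ 0 0), !Rminus_0_r in LZ by lra.
  set (X := clamp _ _ x) in *. set (Y := clamp _ _ y) in *. set (W := clamp _ _ z) in *.
  unfold Rminus at 1. eapply Rle_trans; [apply Rabs_triang |].
  rewrite Rabs_Ropp, !Rabs_mult.
  rewrite (Rabs_right 2), (Rabs_right lambda), (Rabs_right Y), (Rabs_right (1 + lambda))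
    by lra.
  assert (AX : Rabs X <= xbound alpha beta t) by now apply Rabs_le.
  assert (PX := Rabs_pos X). assert (PW := Rabs_pos W). assert (PY := Rabs_pos (Y - 1)).
  apply Rplus_le_compat.
  - replace (2 * lambda * Rabs (Y - 1) * Y) with (2 * lambda * (Y * Rabs (Y - 1))) by ring.
    replace (2 * lambda * beta * Rabs (y - 1)) with (2 * lambda * (beta * Rabs (y - 1)))
      by ring.
    apply Rmult_le_compat_l; [lra |]. apply Rmult_le_compat; lra.
  - rewrite !Rmult_assoc. apply Rmult_le_compat_l; [lra |].
    apply Rmult_le_compat; lra.
Qed.

(* [y = 1, z = 0] is an equilibrium of the (y, z) equations, so it is not reached in
   finite time. *)
Lemma equilibrium_not_reached lambda alpha beta G g x y z tau :
  0 < lambda -> 1 < beta -> 0 < G ->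
  shot lambda alpha beta G g x y z -> 0 <= tau -> y tau = 1 -> z tau = 0 -> False.
Proof.
  intros Hl Hb HG [_ [Y0 [_ S]]] Ht Hy Hz.
  set (c := (1 + lambda) * xbound alpha beta tau).
  set (F := fun s => trunc lambda alpha beta G s (x s) (y s) (z s)).
  set (E := fun s => (y s - 1) * (y s - 1) + z s * z s).
  set (dE := fun s => 2 * ((y s - 1) * z s) + 2 * (z s * F s)).
  (* The squared distance to the equilibrium decays at most exponentially: 1 accounts for 2 (y - 1)
     z, the other two constants for the bound on the right-hand side. It starts from at least (beta
     - 1)^2 > 0. *)
  assert (Hg : E 0 * exp (- (1 + 2 * lambda * beta + 2 * c) * (tau - 0)) <= E tau).
  { apply (gronwall_lower E dE); [easy | |].
    - intros s Hs. destruct (S s ltac:(lra)) as [_ [Dy Dz]]. fold (F s) in Dz.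
      assert (Dq : forall (u : R -> R) du, is_derive u s du ->
        is_derive (fun r : R => u r * u r) s (2 * (u s * du))).
      { intros u du Hu. replace (2 * (u s * du)) with (du * u s + u s * du) by ring.
        apply (is_derive_mult u u s); auto. intros; apply Rmult_comm. }
      unfold E, dE.
      apply (is_derive_plus (fun r => (y r - 1) * (y r - 1)) (fun r => z r * z r) s).
      + apply (Dq (fun r => y r - 1)). replace (z s) with (z s - 0) by ring.
        apply (is_derive_minus y (fun _ => 1) s); [easy | apply (is_derive_const 1 s)].
      + now apply Dq.
    - intros s Hs.
      assert (A := trunc_abs_le lambda alpha beta G s (x s) (y s) (z s) Hl Hb HG).
      fold (F s) in A.
      assert (HN := xbound_increasing alpha beta s tau Hb Hs).
      assert (Pz := Rabs_pos (z s)). assert (Py := Rabs_pos (y s - 1)).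
      assert (A' : Rabs (F s) <= 2 * lambda * beta * Rabs (y s - 1) + c * Rabs (z s)).
      { apply Rle_trans with (1 := A). apply Rplus_le_compat_l.
        apply Rmult_le_compat_r; [easy |]. apply Rmult_le_compat_l; lra. }
      unfold E, dE.
      assert (B : - (z s * F s) <= Rabs (z s) * Rabs (F s)).
      { rewrite <- Rabs_mult, <- Rabs_Ropp. apply Rle_abs. }
      assert (B' := Rmult_le_compat_l _ _ _ Pz A').
      assert (Sq : forall v, Rabs v * Rabs v = v * v).
      { intros v. rewrite <- Rabs_mult. apply Rabs_right, Rle_ge, Rle_0_sqr. }
      assert (Sz := Sq (z s)). assert (Sy := Sq (y s - 1)).
      assert (Q1 := pow2_ge_0 (y s - 1 + z s)).
      assert (Q2 := pow2_ge_0 (Rabs (y s - 1) - Rabs (z s))).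
      set (p := Rabs (z s)) in *. set (q := Rabs (y s - 1)) in *.
      assert (Hlb : 0 <= lambda * beta) by nra.
      assert (Q3 : lambda * beta * (2 * (p * q)) <= lambda * beta * (p * p + q * q))
        by (apply Rmult_le_compat_l; lra).
      assert (Hc : 0 <= c).
      { unfold c. assert (N := xbound_pos alpha beta tau Hb). nra. }
      assert (Q4 : 0 <= c * (q * q)) by (apply Rmult_le_pos; [easy | apply Rle_0_sqr]).
      rewrite <- Sz, <- Sy. nra. }
  unfold E in Hg. rewrite Hy, Hz, Y0 in Hg.
  assert (P := exp_pos (- (1 + 2 * lambda * beta + 2 * c) * (tau - 0))).
  assert (0 < ((beta - 1) * (beta - 1) + z 0 * z 0)) by nra.
  assert (Q := Rmult_lt_0_compat _ _ H P). lra.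
Qed.

(** At the first zero of min(y - 1, -z) the orbit is on one of the two sides, which is an exit, or
    at the corner, which is the equilibrium. *)
Lemma no_exit lambda alpha beta G g x y z :
  0 < lambda -> 1 < beta -> 0 < G -> g < 0 ->
  shot lambda alpha beta G g x y z -> ~ convex_exit y z -> ~ low_exit y z ->
  forall t, 0 <= t -> 1 < y t /\ z t < 0.
Proof.
  intros Hl Hb HG Hg S HA HB t Ht.
  set (p := fun s => Rmin (y s - 1) (- z s)).
  destruct (Rlt_le_dec 0 (p t)) as [Hp | Hp].
  { unfold p in Hp. apply Rmin_Rgt in Hp. lra. }
  exfalso. destruct (first_zero p t Ht) as [tau [Htau [Hz Hpos]]]; auto.
  - intros s Hs. destruct (shot_continuous _ _ _ _ _ _ _ _ s S) as [Cy Cz]; [lra |].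
    unfold p. apply continuous_Rmin.
    + apply (continuous_minus y (fun _ => 1)); [easy | apply continuous_const].
    + now apply (continuous_opp z).
  - destruct S as [_ [Y0 [Z0 _]]]. unfold p. rewrite Y0, Z0. apply Rmin_glb_lt; lra.
  - assert (Hb' : forall s, 0 <= s < tau -> 1 < y s /\ z s < 0).
    { intros s Hs. specialize (Hpos s Hs). unfold p in Hpos.
      apply Rmin_Rgt in Hpos. lra. }
    assert (H1 := Rmin_l (y tau - 1) (- z tau)).
    assert (H2 := Rmin_r (y tau - 1) (- z tau)). unfold p in Hz.
    destruct (Req_dec (y tau) 1) as [Ey | Ey].
    + destruct (Req_dec (z tau) 0) as [Ez | Ez].
      * apply (equilibrium_not_reached lambda alpha beta G g x y z tau); auto. lra.
      * apply HB. apply (low_exit_at lambda alpha beta G g x y z tau); auto; [lra |].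
        intros s Hs. destruct (Req_dec s tau) as [-> |]; [lra |]. apply Hb'. lra.
    + apply HA. apply (convex_exit_at lambda alpha beta G g x y z tau); auto; [lra | |].
      * revert Hz. unfold Rmin. destruct Rle_dec; lra.
      * intros s Hs. destruct (Req_dec s tau) as [-> |]; [lra |]. apply Hb'. lra.
Qed.

(** If -z stays above beta on [0, 1], the slope drops from beta to at most 0. While -z >= beta it
    decays at rate at most [M + K], and this rate is independent of [G], so [G] can be chosen
    afterwards although it also enters the truncation. *)
Lemma steep_low_exit lambda alpha beta :
  0 < lambda -> 1 < beta ->
  exists G, 0 < G /\ forall x y z, shot lambda alpha beta G (- G) x y z -> low_exit y z.
Proof.
  intros Hl Hb.
  set (M := (1 + lambda) * xbound alpha beta 1). set (K := 2 * lambda * (beta * beta)).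
  assert (HN := xbound_pos alpha beta 1 Hb).
  assert (HM : 0 < M) by (apply Rmult_lt_0_compat; lra).
  assert (HK : 0 < K) by (apply Rmult_lt_0_compat; nra).
  assert (He : 1 <= exp (M + K)) by (assert (Q := exp_ineq1_le (M + K)); lra).
  (* The exponential compensates the decay over unit time, leaving [beta + 1], which exceeds the
     level [beta] of the first zero. *)
  set (G := (beta + 1) * exp (M + K)).
  assert (HG : beta + 1 <= G) by (unfold G; nra).
  exists G. split; [lra |]. intros x y z Sh. assert (Sh' := Sh).
  destruct Sh' as [X0 [Y0 [Z0 S]]].
  assert (Hz : forall s, 0 <= s <= 1 -> 0 < - z s - beta).
  { intros s Hs. apply Rnot_le_lt. intros Hn.
    destruct (first_zero (fun r => - z r - beta) s) as [tau [Htau [Et Hpos]]];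
      auto; try lra.
    - intros r Hr. destruct (shot_continuous _ _ _ _ _ _ _ _ r Sh) as [_ Cz]; [lra |].
      apply (continuous_minus (fun r => - z r) (fun _ => beta)); [| apply continuous_const].
      now apply (continuous_opp z).
    - assert (B : - z 0 * exp (- (M + K) * (tau - 0)) <= - z tau).
      { apply (gronwall_lower (fun r => - z r)
          (fun r => - trunc lambda alpha beta G r (x r) (y r) (z r))); [lra | |].
        - intros r Hr. apply (is_derive_opp z r). apply S. lra.
        - intros r Hr. cbv beta.
          assert (Hzr : beta <= - z r).
          { destruct (Req_dec r tau) as [-> |]; [lra |]. specialize (Hpos r). lra. }
          unfold trunc, rhs.
          assert (N := xbound_pos alpha beta r Hb).
          assert (N1 := xbound_increasing alpha beta r 1 Hb ltac:(lra)).
          assert (Z := zbound_pos lambda alpha beta G r ltac:(lra)).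
          assert (BX := clamp_bounds (- xbound alpha beta r) (xbound alpha beta r) (x r)
                          ltac:(lra)).
          assert (BY := clamp_bounds 1 beta (y r) ltac:(lra)).
          (* Clamping moves a negative [z] only towards 0, so its size is bounded without
             [zbound]. *)
          assert (BW : z r <= clamp (- zbound lambda alpha beta G r) 0 (z r) <= 0).
          { unfold clamp, Rmax, Rmin. repeat destruct Rle_dec; lra. }
          set (X := clamp _ _ (x r)) in *. set (Y := clamp _ _ (y r)) in *.
          set (W := clamp _ _ (z r)) in *.
          assert (AY : (Y - 1) * Y <= beta * beta) by (apply Rmult_le_compat; lra).
          assert (AX : - (X * W) <= xbound alpha beta 1 * - z r).
          { apply Rle_trans with (xbound alpha beta 1 * - W); [nra |].
            apply Rmult_le_compat_l; lra. }
          assert (AX' := Rmult_le_compat_l (1 + lambda) _ _ ltac:(lra) AX).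
          assert (AY' := Rmult_le_compat_l (2 * lambda) _ _ ltac:(lra) AY).
          (* Since -z >= beta > 1, the constant [K] is absorbed into a term linear in -z. *)
          assert (AK : K * 1 <= K * - z r) by (apply Rmult_le_compat_l; lra).
          unfold K, M in *. lra. }
      rewrite Z0 in B. replace (- z tau) with beta in B by lra.
      replace (- (M + K) * (tau - 0)) with (- ((M + K) * tau)) in B by ring.
      assert (C : exp (- (M + K)) <= exp (- ((M + K) * tau))).
      { destruct (Req_dec tau 1) as [-> |]; [right; f_equal; ring |].
        apply Rlt_le, exp_increasing. nra. }
      assert (D : G * exp (- (M + K)) = beta + 1).
      { unfold G. rewrite Rmult_assoc, <- exp_plus, Rplus_opp_r, exp_0. ring. }
      assert (G * exp (- (M + K)) <= G * exp (- ((M + K) * tau)))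
        by (apply Rmult_le_compat_l; lra).
      lra. }
  exists 1. split; [lra | split].
  - assert (D := increment_le_linear y z (- beta) 0 1 ltac:(lra)
      (fun s Hs => proj1 (proj2 (S s ltac:(lra))))
      (fun s Hs => ltac:(specialize (Hz s Hs); lra))).
    lra.
  - intros s Hs. specialize (Hz s Hs). lra.
Qed.

Lemma critical_shot lambda alpha beta :
  0 < lambda -> 1 < beta ->
  exists G g x y z, 0 < G /\ - G <= g < 0 /\ shot lambda alpha beta G g x y z /\
    forall t, 0 <= t -> 1 < y t /\ z t < 0.
Proof.
  intros Hl Hb. destruct (steep_low_exit lambda alpha beta Hl Hb) as [G [HG HB]].
  set (B := fun g => - G <= g <= 0 /\
    exists x y z, shot lambda alpha beta G g x y z /\ low_exit y z).
  destruct (completeness B) as [g [Hub Hlub]].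
  { exists 0. intros g [Hg _]. lra. }
  { exists (- G). split; [lra |].
    destruct (shot_exists lambda alpha beta G (- G) Hl Hb HG) as [x [y [z S]]].
    exists x, y, z. split; [easy |]. eapply HB, S. }
  assert (Hg0 : g <= 0) by (apply Hlub; intros r [Hr _]; lra).
  assert (HgG : - G <= g).
  { apply Hub. split; [lra |].
    destruct (shot_exists lambda alpha beta G (- G) Hl Hb HG) as [x [y [z S]]].
    exists x, y, z. split; [easy |]. eapply HB, S. }
  destruct (shot_exists lambda alpha beta G g Hl Hb HG) as [x [y [z S]]].
  assert (HA : ~ convex_exit y z).
  { intros HA. destruct (convex_exit_open _ _ _ _ _ _ _ _ Hl Hb HG S HA) as [d [Hd HO]].
    (* Curvatures within [d] of [g] all give convex exits, so [g - d] would be a smaller upper bound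
       of [B]. *)
    assert (g <= g - d); [| lra]. apply Hlub. intros r Hr.
    assert (r <= g) by now apply Hub.
    destruct (Rle_lt_dec r (g - d)) as [|Hrd]; [easy |]. exfalso.
    destruct Hr as [_ [x' [y' [z' [S' L']]]]].
    apply (exits_exclusive y' z'); auto. eapply HO; eauto. apply Rabs_lt_between. lra. }
  assert (Hg : g < 0).
  { destruct Hg0 as [|Hg0]; [easy |]. exfalso. apply HA. destruct (S) as [_ [Y0 [Z0 _]]].
    apply (convex_exit_at lambda alpha beta G g x y z 0); auto; try lra.
    intros s Hs. replace s with 0 by lra. lra. }
  assert (HL : ~ low_exit y z).
  { intros HL. destruct (low_exit_open _ _ _ _ _ _ _ _ Hl Hb HG S HL) as [d [Hd HO]].
    assert (Hm : 0 < Rmin d (- g)) by (apply Rmin_glb_lt; lra).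
    assert (H1 := Rmin_l d (- g)). assert (H2 := Rmin_r d (- g)).
    (* The minimum with [- g] keeps the larger curvature at most 0, hence in the range over which
       [B] is defined. *)
    enough (g + Rmin d (- g) / 2 <= g) by lra. apply Hub.
    split; [lra |].
    destruct (shot_exists lambda alpha beta G (g + Rmin d (- g) / 2) Hl Hb HG)
      as [x' [y' [z' S']]].
    exists x', y', z'. split; [easy |]. eapply HO; eauto. apply Rabs_lt_between. lra. }
  exists G, g, x, y, z. split; [easy | split; [easy | split; [easy |]]].
  now apply (no_exit lambda alpha beta G g x y z).
Qed.

(** Monotonicity bounds y by beta, and integration bounds x. For z, the nonnegative term in y is
    dropped and the clamped values give z' >= - (1 + lambda) xbound zbound, the derivative of -
    zbound; since z(0) >= -G, z stays above - zbound. The estimate concerns the truncated equation,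
    so it is not circular. *)
Lemma shot_inactive lambda alpha beta G g x y z :
  0 < lambda -> 1 < beta -> 0 < G -> - G <= g ->
  shot lambda alpha beta G g x y z ->
  (forall t, 0 <= t -> 1 < y t /\ z t < 0) ->
  ode_solution (fun _ => rhs lambda) x y z.
Proof.
  intros Hl Hb HG Hg [X0 [Y0 [Z0 S]]] Hyz.
  assert (Hy : forall t, 0 <= t -> y t <= beta).
  { intros t Ht. rewrite <- Y0. replace (y 0) with (y 0 + 0 * (t - 0)) by ring.
    apply (increment_le_linear y z 0 0 t Ht).
    - intros s Hs. apply S. lra.
    - intros s Hs. destruct (Hyz s); lra. }
  assert (Hx : forall t, 0 <= t -> Rabs (x t) <= xbound alpha beta t).
  { intros t Ht.
    assert (A := increment_abs_le x (fun s => beta * s) y (fun _ => beta) 0 t Ht).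
    cbv beta in A. rewrite X0 in A.
    assert (B : Rabs (x t - alpha) <= beta * t - beta * 0).
    { apply A.
      - intros s Hs. apply S. lra.
      - intros s _. auto_derive; [easy | ring].
      - intros s Hs. destruct (Hyz s ltac:(lra)). specialize (Hy s ltac:(lra)).
        apply Rabs_le. lra. }
    replace (x t) with (alpha + (x t - alpha)) by ring.
    eapply Rle_trans; [apply Rabs_triang |]. unfold xbound.
    assert (0 <= beta * (1 + t ^ 2 - t)) by (apply Rmult_le_pos; nra). lra. }
  assert (Hz : forall t, 0 <= t -> - zbound lambda alpha beta G t <= z t).
  { intros t Ht.
    assert (A := increment_le (fun s => - zbound lambda alpha beta G s) z
      (fun s => - ((1 + lambda) * xbound alpha beta s * zbound lambda alpha beta G s))
      (fun s => trunc lambda alpha beta G s (x s) (y s) (z s)) 0 t Ht).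
    cbv beta in A. rewrite Z0 in A.
    assert (E0 : zbound lambda alpha beta G 0 = G).
    { unfold zbound. rewrite pow_ne_zero by easy.
      replace ((1 + lambda) * ((Rabs alpha + beta) * 0 + beta * (0 / 3))) with 0 by field.
      rewrite exp_0. ring. }
    rewrite E0 in A.
    enough (- zbound lambda alpha beta G t - - G <= z t - g) by lra.
    apply A.
    - intros s _. apply (is_derive_opp (zbound lambda alpha beta G) s), is_derive_zbound.
    - intros s Hs. apply S. lra.
    - intros s Hs. unfold trunc, rhs.
      assert (N := xbound_pos alpha beta s Hb).
      assert (Z := zbound_pos lambda alpha beta G s HG).
      assert (BX := clamp_bounds (- xbound alpha beta s) (xbound alpha beta s) (x s)
                      ltac:(lra)).
      assert (BY := clamp_bounds 1 beta (y s) ltac:(lra)).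
      assert (BW := clamp_bounds (- zbound lambda alpha beta G s) 0 (z s) ltac:(lra)).
      set (X := clamp _ _ (x s)) in *. set (Y := clamp _ _ (y s)) in *.
      set (W := clamp _ _ (z s)) in *.
      assert (AY : 0 <= 2 * lambda * (Y - 1) * Y)
        by (repeat apply Rmult_le_pos; lra).
      assert (AX : X * W <= xbound alpha beta s * zbound lambda alpha beta G s).
      { apply Rle_trans with (xbound alpha beta s * - W); [nra |].
        apply Rmult_le_compat_l; lra. }
      assert (AX' := Rmult_le_compat_l (1 + lambda) _ _ ltac:(lra) AX). lra. }
  intros t Ht. destruct (S t Ht) as [Dx [Dy Dz]]. split; [easy | split; [easy |]].
  specialize (Hx t Ht). specialize (Hy t Ht). specialize (Hz t Ht).
  destruct (Hyz t Ht). apply Rabs_le_between in Hx.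
  unfold trunc in Dz. rewrite !clamp_id in Dz by lra. exact Dz.
Qed.

Lemma slope_tends_to_one lambda alpha x y z :
  0 < lambda -> x 0 = alpha -> ode_solution (fun _ => rhs lambda) x y z ->
  (forall t, 0 <= t -> 1 < y t /\ z t < 0) ->
  is_lim y p_infty 1.
Proof.
  intros Hl X0 S Hyz.
  assert (Hdec : forall s t, 0 <= s <= t -> y t <= y s).
  { intros s t Hst. replace (y s) with (y s + 0 * (t - s)) by ring.
    apply (increment_le_linear y z 0 s t); [easy | |].
    - intros r Hr. apply S. lra.
    - intros r Hr. destruct (Hyz r); lra. }
  assert (Hex : forall eps, 0 < eps -> exists t, 0 <= t /\ y t < 1 + eps).
  { intros eps Heps. apply Classical_Prop.NNPP. intros Hn.
    assert (Hy : forall t, 0 <= t -> 1 + eps <= y t).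
    { intros t Ht. apply Rnot_lt_le. intros Hlt. apply Hn. now exists t. }
    set (a := Rabs alpha).
    assert (Ha : 0 <= a) by apply Rabs_pos.
    (* A slope of at least 1 gives x t >= alpha + t, nonnegative from time |alpha| on. *)
    assert (Hx : forall t, a <= t -> 0 <= x t).
    { intros t Hat.
      assert (A := increment_le (fun s => s) x (fun _ => 1) y 0 t ltac:(lra)).
      cbv beta in A. rewrite X0 in A.
      assert (B : t - 0 <= x t - alpha).
      { apply A.
        - intros s _. apply (is_derive_id s).
        - intros s Hs. apply S. lra.
        - intros s Hs. specialize (Hy s). lra. }
      assert (C := Rle_abs (- alpha)). rewrite Rabs_Ropp in C. fold a in C. lra. }
    set (k := 2 * lambda * eps).
    assert (Hk : 0 < k) by (apply Rmult_lt_0_compat; lra).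
    (* Growth at rate at least [k] from time [a] brings [z] up to 0 by this time. *)
    set (t := a + (- z a) / k).
    assert (Hza : z a < 0) by now apply Hyz.
    assert (Ht : a < t) by (assert (0 < - z a / k) by (apply Rdiv_lt_0_compat; lra); unfold t; lra).
    assert (A := increment_le (fun s => k * s) z (fun _ => k)
      (fun s => rhs lambda (x s) (y s) (z s)) a t ltac:(lra)).
    cbv beta in A.
    assert (B : k * t - k * a <= z t - z a).
    { apply A.
      - intros s _. auto_derive; [easy | ring].
      - intros s Hs. apply S. lra.
      - intros s Hs. unfold rhs, k. specialize (Hx s ltac:(lra)).
        specialize (Hy s ltac:(lra)). destruct (Hyz s ltac:(lra)) as [_ Hzs].
        assert (P : 0 <= (1 + lambda) * (x s * - z s))
          by (repeat apply Rmult_le_pos; lra).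
        assert (Q : eps * 1 <= (y s - 1) * y s) by (apply Rmult_le_compat; lra).
        assert (Q' := Rmult_le_compat_l (2 * lambda) _ _ ltac:(lra) Q). lra. }
    replace (k * t - k * a) with (- z a) in B by (unfold t; field; lra).
    destruct (Hyz t); lra. }
  apply is_lim_spec. intros eps. destruct (Hex eps (cond_pos eps)) as [t [Ht Hy]].
  exists t. intros s Hs. specialize (Hdec t s ltac:(lra)).
  destruct (Hyz s ltac:(lra)). apply Rabs_lt_between. lra.
Qed.

(** * Comparison and uniqueness *)

(** Continuing [f] to the left of 0 by its tangent line turns the one-sided derivative at 0 into a
    two-sided one, so that [is_derive] applies on the closed half-line. *)
Lemma halfline_extension (f f' : R -> R) :
  has_derivative_on_halfline f f' ->
  exists F : R -> R, (forall t, 0 <= t -> F t = f t) /\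
    forall t, 0 <= t -> is_derive F t (f' t).
Proof.
  intros H. set (F := fun t => if Rle_dec 0 t then f t else f 0 + f' 0 * t).
  assert (HF : forall t, 0 <= t -> F t = f t).
  { intros t Ht. unfold F. destruct (Rle_dec 0 t); [easy | lra]. }
  exists F. split; [easy |]. intros t Ht. apply is_derive_Reals. intros eps Heps.
  destruct (H t Ht eps Heps) as [d [Hd HD]]. simpl in HD. unfold Rdist in HD.
  assert (Hin : forall h, h <> 0 -> Rabs h < d -> 0 <= t + h ->
    Rabs ((F (t + h) - F t) / h - f' t) < eps).
  { intros h Hh Hhd Hth. rewrite (HF t Ht), (HF (t + h) Hth).
    specialize (HD (t + h)). replace (t + h - t) with h in HD by ring. apply HD.
    split; [| easy]. split; [exact Hth | lra]. }
  destruct Ht as [Ht | <-].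
  - assert (Hm : 0 < Rmin d t) by now apply Rmin_glb_lt.
    exists (mkposreal _ Hm). simpl. intros h Hh Hhm.
    assert (H1 := Rmin_l d t). assert (H2 := Rmin_r d t).
    apply Hin; [easy | lra |]. apply Rabs_lt_between in Hhm. lra.
  - exists (mkposreal _ Hd). simpl. intros h Hh Hhm.
    destruct (Rle_lt_dec 0 h); [apply Hin; auto; lra |].
    rewrite (HF 0) by lra. rewrite Rplus_0_l. unfold F.
    destruct (Rle_dec 0 h); [lra |].
    replace ((f 0 + f' 0 * h - f 0) / h - f' 0) with 0 by (field; lra).
    now rewrite Rabs_R0.
Qed.

Lemma is_derive_on_halfline (f f' : R -> R) :
  (forall t, 0 <= t -> is_derive f t (f' t)) -> has_derivative_on_halfline f f'.
Proof.
  intros H t Ht eps Heps. destruct (proj1 (is_derive_Reals f t (f' t)) (H t Ht) eps Heps)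
    as [d Hd].
  exists d. split; [apply cond_pos |]. simpl. unfold Rdist.
  intros s [[_ Hst] Hsd]. specialize (Hd (s - t) ltac:(lra) Hsd).
  now replace (t + (s - t)) with s in Hd by ring.
Qed.

Lemma bvp_solution_ode lambda alpha beta f f' f'' f''' :
  is_bvp_solution lambda alpha beta f f' f'' f''' ->
  (forall t, halfline t -> f'' t < 0) ->
  exists x y z,
    (forall t, 0 <= t -> x t = f t) /\
    x 0 = alpha /\ y 0 = beta /\ ode_solution (fun _ => rhs lambda) x y z /\
    (forall t, 0 <= t -> z t < 0) /\ is_lim y p_infty 1.
Proof.
  intros [D1 [D2 [D3 [E [H0 [H0' HL]]]]]] Hc.
  destruct (halfline_extension f f' D1) as [x [Ex Dx]].
  destruct (halfline_extension f' f'' D2) as [y [Ey Dy]].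
  destruct (halfline_extension f'' f''' D3) as [z [Ez Dz]].
  assert (P0 : 0 <= 0) by lra.
  exists x, y, z. split; [easy |]. split; [now rewrite Ex |].
  split; [now rewrite Ey |]. split; [| split].
  - intros t Ht. split; [| split].
    + rewrite (Ey t Ht). now apply Dx.
    + rewrite (Ez t Ht). now apply Dy.
    + specialize (Dz t Ht). specialize (E t Ht).
      replace (rhs lambda (x t) (y t) (z t)) with (f''' t); [easy |].
      rewrite (Ex t Ht), (Ey t Ht), (Ez t Ht). unfold rhs. lra.
  - intros t Ht. rewrite (Ez t Ht). now apply Hc.
  - apply (is_lim_ext_loc f'); [| easy]. exists 0. intros t Ht. symmetry. apply Ey. lra.
Qed.

(** If y t <= l, the negative derivative brings y strictly below l soon afterwards, and monotonicity
    keeps it away from l. *)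
Lemma slope_above_limit (y z : R -> R) (l : R) :
  (forall t, 0 <= t -> is_derive y t (z t)) ->
  (forall t, 0 <= t -> z t < 0) -> is_lim y p_infty l ->
  forall t, 0 <= t -> l < y t.
Proof.
  intros Dy Hz HL t Ht. apply Rnot_le_lt. intros Hy.
  destruct (derive_pos_locally (fun s => - y s) t (- z t)) as [d [Hd [Hr _]]].
  { apply (is_derive_opp y t). now apply Dy. }
  { specialize (Hz t Ht). lra. }
  specialize (Hr (t + d / 2) ltac:(lra)). set (s := t + d / 2) in *.
  apply is_lim_spec in HL. destruct (HL (mkposreal (l - y s) ltac:(lra))) as [M HM].
  simpl in HM. assert (H1 := Rmax_l (M + 1) s). assert (H2 := Rmax_r (M + 1) s).
  specialize (HM (Rmax (M + 1) s) ltac:(lra)). apply Rabs_lt_between in HM.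
  assert (A := increment_le_linear y z 0 s (Rmax (M + 1) s) H2
    (fun r Hr' => Dy r ltac:(unfold s in *; lra))
    (fun r Hr' => Rlt_le _ _ (Hz r ltac:(unfold s in *; lra)))).
  lra.
Qed.

(* At a first zero of [z1 - z2] one has [x1 >= x2], [y1 > y2] and [z1 = z2 < 0], hence
   [(z1 - z2)' > 0]. *)
Lemma curvature_comparison lambda x1 y1 z1 x2 y2 z2 :
  0 < lambda ->
  ode_solution (fun _ => rhs lambda) x1 y1 z1 ->
  ode_solution (fun _ => rhs lambda) x2 y2 z2 ->
  (forall t, 0 <= t -> 1 < y1 t /\ z1 t < 0) ->
  (forall t, 0 <= t -> 1 < y2 t /\ z2 t < 0) ->
  x1 0 = x2 0 -> y1 0 = y2 0 -> is_lim y1 p_infty 1 -> is_lim y2 p_infty 1 ->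
  z1 0 <= z2 0.
Proof.
  intros Hl S1 S2 H1 H2 X0 Y0 L1 L2. apply Rnot_lt_le. intros Z0.
  set (p := fun t => z1 t - z2 t). set (Y := fun t => y1 t - y2 t).
  assert (DY : forall t, 0 <= t -> is_derive Y t (p t)).
  { intros t Ht. apply (is_derive_minus y1 y2 t); [apply S1 | apply S2]; easy. }
  assert (Dp : forall t, 0 <= t -> is_derive p t
    (rhs lambda (x1 t) (y1 t) (z1 t) - rhs lambda (x2 t) (y2 t) (z2 t))).
  { intros t Ht. apply (is_derive_minus z1 z2 t); [apply S1 | apply S2]; easy. }
  (* [Y] starts at 0, so strict positivity has to come from its derivative at 0; it is used at the
     first zero of [p] and again for the limits. *)
  destruct (derive_pos_locally Y 0 (p 0) (DY 0 (Rle_refl 0))) as [d [Hd [HY _]]].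
  { unfold p. lra. }
  assert (Y00 : Y 0 = 0) by (unfold Y; lra).
  assert (HYmono : forall s t, 0 <= s <= t -> (forall r, s <= r <= t -> 0 <= p r) ->
    Y s <= Y t).
  { intros s t Hst Hp.
    assert (A := increment_le (fun _ => 0) Y (fun _ => 0) p s t ltac:(lra)
      (fun r _ => is_derive_const 0 r) (fun r Hr => DY r ltac:(lra)) Hp).
    cbv beta in A. lra. }
  assert (Hp : forall t, 0 <= t -> 0 < p t).
  { intros t Ht. apply Rnot_le_lt. intros Hn.
    destruct (first_zero p t Ht) as [tau [Htau [Et Hpos]]]; auto.
    - intros s Hs. eapply is_derive_continuous. apply Dp. lra.
    - unfold p. lra.
    - assert (Hpos' : forall s, 0 <= s <= tau -> 0 <= p s).
      { intros s Hs. destruct (Req_dec s tau) as [-> |]; [lra |].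
        apply Rlt_le, Hpos. lra. }
      assert (HYt : 0 < Y tau).
      { assert (Hm : 0 < Rmin d tau) by (apply Rmin_glb_lt; lra).
        assert (M1 := Rmin_l d tau). assert (M2 := Rmin_r d tau).
        specialize (HY (Rmin d tau / 2) ltac:(lra)). rewrite Y00 in HY.
        specialize (HYmono (Rmin d tau / 2) tau ltac:(lra)).
        apply Rlt_le_trans with (1 := HY), HYmono. intros r Hr. apply Hpos'. lra. }
      assert (HX : 0 <= x1 tau - x2 tau).
      { assert (A := increment_le x2 x1 y2 y1 0 tau ltac:(lra)
          (fun r Hr => proj1 (S2 r ltac:(lra))) (fun r Hr => proj1 (S1 r ltac:(lra)))).
        enough (x2 tau - x2 0 <= x1 tau - x1 0) by lra. apply A. intros r Hr.
        enough (Y 0 <= Y r) by (unfold Y in *; lra). apply HYmono; [lra |].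
        intros q Hq. apply Hpos'. lra. }
      (* A positive derivative at the zero [tau] would make [p] negative just before it. *)
      destruct (derive_pos_locally p tau _ (Dp tau ltac:(lra))) as [d' [Hd' [_ Hlft]]].
      + destruct (H1 tau ltac:(lra)) as [Y1 Z1]. destruct (H2 tau ltac:(lra)) as [Y2 Z2].
        unfold p in Et. assert (Ez : z1 tau = z2 tau) by lra. unfold rhs. rewrite Ez.
        unfold Y in HYt.
        assert (A : 0 < lambda * ((y1 tau - y2 tau) * (y1 tau + y2 tau - 1)))
          by (repeat apply Rmult_lt_0_compat; lra).
        assert (B : 0 <= (1 + lambda) * ((x1 tau - x2 tau) * - z2 tau))
          by (repeat apply Rmult_le_pos; lra).
        lra.
      + assert (Hm : 0 < Rmin d' tau) by (apply Rmin_glb_lt; lra).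
        assert (M1 := Rmin_l d' tau). assert (M2 := Rmin_r d' tau).
        specialize (Hlft (tau - Rmin d' tau / 2) ltac:(lra)).
        specialize (Hpos (tau - Rmin d' tau / 2) ltac:(lra)). lra. }
  (* With [p] positive throughout, [Y] stays above its value at [d / 2]; once both slopes are within
     half that value of 1, this is impossible. *)
  specialize (HY (d / 2) ltac:(lra)). rewrite Y00 in HY.
  apply is_lim_spec in L1, L2.
  destruct (L1 (mkposreal (Y (d / 2) / 2) ltac:(lra))) as [M1 HM1].
  destruct (L2 (mkposreal (Y (d / 2) / 2) ltac:(lra))) as [M2 HM2]. simpl in HM1, HM2.
  set (t := Rmax (d / 2) (Rmax (M1 + 1) (M2 + 1))).
  assert (T1 : d / 2 <= t) by apply Rmax_l.
  assert (T2 : Rmax (M1 + 1) (M2 + 1) <= t) by apply Rmax_r.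
  assert (T3 := Rmax_l (M1 + 1) (M2 + 1)). assert (T4 := Rmax_r (M1 + 1) (M2 + 1)).
  specialize (HM1 t ltac:(lra)). specialize (HM2 t ltac:(lra)).
  apply Rabs_lt_between in HM1, HM2.
  assert (A : Y (d / 2) <= Y t).
  { apply HYmono; [lra |]. intros r Hr. apply Rlt_le, Hp. lra. }
  unfold Y in *. lra.
Qed.

(** The original right-hand side is only locally Lipschitz; bounds of the two given solutions on
    [0, T] supply the constant, and zero initial distance forces equality. *)
Lemma initial_value_unique lambda x1 y1 z1 x2 y2 z2 :
  0 < lambda ->
  ode_solution (fun _ => rhs lambda) x1 y1 z1 ->
  ode_solution (fun _ => rhs lambda) x2 y2 z2 ->
  x1 0 = x2 0 -> y1 0 = y2 0 -> z1 0 = z2 0 ->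
  forall t, 0 <= t -> x1 t = x2 t.
Proof.
  intros Hl S1 S2 X0 Y0 Z0 T HT.
  assert (Hbd : forall u : R -> R, (forall t, 0 <= t -> continuous u t) ->
    exists B, 0 <= B /\ forall t, 0 <= t <= T -> Rabs (u t) <= B).
  { intros u Hu. destruct (continuity_ab_maj (fun t => Rabs (u t)) 0 T HT) as [m [Hm _]].
    - intros c Hc. apply continuity_pt_filterlim, (continuous_Rabs_comp u), Hu. lra.
    - exists (Rabs (u m)). split; [apply Rabs_pos | easy]. }
  assert (C1 : forall t, 0 <= t -> continuous x1 t /\ continuous y1 t).
  { intros t Ht. destruct (S1 t Ht) as [a [b _]].
    split; eapply is_derive_continuous; eassumption. }
  assert (C2 : forall t, 0 <= t -> continuous y2 t /\ continuous z2 t).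
  { intros t Ht. destruct (S2 t Ht) as [_ [b c]].
    split; eapply is_derive_continuous; eassumption. }
  destruct (Hbd x1) as [N [HN BN]]; [apply C1 |].
  destruct (Hbd z2) as [Z [HZ BZ]]; [apply C2 |].
  destruct (Hbd (fun t => y1 t + y2 t - 1)) as [Y [HY BY]].
  { intros t Ht. apply (continuous_minus (fun s => y1 s + y2 s) (fun _ => 1));
      [| apply continuous_const].
    apply (continuous_plus y1 y2); [apply C1 | apply C2]; easy. }
  destruct (ode_dist x1 y1 z1 (fun s => rhs lambda (x1 s) (y1 s) (z1 s))
    x2 y2 z2 (fun s => rhs lambda (x2 s) (y2 s) (z2 s))
    ((1 + lambda) * (N + Z) + 2 * lambda * Y) T) with (t := T) as [D _]; auto.
  - apply Rplus_le_le_0_compat; repeat apply Rmult_le_pos; lra.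
  - intros s Hs. apply S1. lra.
  - intros s Hs. apply S2. lra.
  - intros s Hs. apply rhs_lipschitz; auto.
  - lra.
  - rewrite Z0, Rminus_diag, Rabs_R0, Rmult_0_l in D.
    assert (P := Rabs_pos (x1 T - x2 T)).
    apply Rminus_diag_uniq, Rabs_eq_0. lra.
Qed.

Theorem theorem2 :
  forall lambda : R, 0 < lambda ->
  forall alpha beta : R, 1 < beta ->
  exists f : R -> R,
    is_concave_solution lambda alpha beta f /\
    (forall g : R -> R, is_concave_solution lambda alpha beta g ->
       forall t : R, halfline t -> g t = f t).
Proof.
  intros lambda Hl alpha beta Hb.
  destruct (critical_shot lambda alpha beta Hl Hb) as [G [g [x [y [z [HG [Hg [Sh Hyz]]]]]]]].
  assert (S := shot_inactive lambda alpha beta G g x y z Hl Hb HG ltac:(lra) Sh Hyz).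
  destruct Sh as [X0 [Y0 _]].
  assert (HL := slope_tends_to_one lambda alpha x y z Hl X0 S Hyz).
  exists x. split.
  - exists y, z, (fun t => rhs lambda (x t) (y t) (z t)). split.
    + split; [| split; [| split; [| split; [| split; [| split]]]]]; auto;
        try (apply is_derive_on_halfline; apply S).
      intros t _. unfold rhs. ring.
    + intros t Ht. now apply Hyz.
  - intros f [f' [f'' [f''' [Hf Hc]]]] t Ht.
    destruct (bvp_solution_ode _ _ _ _ _ _ _ Hf Hc)
      as [x' [y' [z' [Ex [X0' [Y0' [S' [Hz' HL']]]]]]]].
    assert (Hyz' : forall s, 0 <= s -> 1 < y' s /\ z' s < 0).
    { intros s Hs. split; [| now apply Hz'].
      apply (slope_above_limit y' z'); auto. intros r Hr. now apply S'. }
    rewrite <- (Ex t Ht).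
    apply (initial_value_unique lambda x' y' z' x y z); auto; try congruence.
    (* Comparing in both orders gives equal initial curvatures. *)
    apply Rle_antisym;
      [apply (curvature_comparison lambda x' y' z' x y z)
      | apply (curvature_comparison lambda x y z x' y' z')]; auto; congruence.
Qed.
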